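(* If $T$ is a quasiconformal tree and $M\subset T$ is closed, then $\dim_L(T/M)=1$.
   Context: A metric space $T$ is a tree if it is compact, connected, locally connected, and every pair of distinct points of $T$ forms the endpoints of a unique Jordan arc (homeomorphic image of $[0,1]$) in $T$. A metric space is $C$-bounded turning ($C\ge1$) if any two points $u,v$ lie in a compact connected set $E$ with $\mathrm{diam}(E)\le C\,d(u,v)$. It is $D$-doubling if every ball of radius $r$ can be covered by at most $D$ balls of radius $r/2$. A quasiconformal (QC) tree is a tree that is $C$-bounded turning and $D$-doubling for some $C,D$. Metric quotient: for a metric space $(X,d)$ and a closed subset $E\subset X$, $X/E$ is the set of equivalence classes of the relation $x\sim y$ iff $x=y$ or $x,y\in E$, with the metric $\rho([a],[b])=\min\{d(a,b),\,d(a,E)+d(b,E)\}$, where $d(a,E)=\inf_{e\in E}d(a,e)$. For $\delta>0$, a $\delta$-chain is a finite sequence $x_0,\dots,x_m$ of points with $d(x_i,x_{i+1})\le\delta$ for all $i<m$. A set $U$ is $\delta$-connected if every pair of points of $U$ is contained in a $\delta$-chain in $U$; a $\delta$-component of a metric space is a maximal $\delta$-connected subset. A map $f:X\to Y$ between metric spaces is Lipschitz light if there are $L,Q>0$ such that $f$ is $L$-Lipschitz and, for every $r>0$ and every $E\subset Y$ with $\mathrm{diam}(E)\le r$, the $r$-components of $f^{-1}(E)$ have diameter at most $Qr$. A metric space $X$ has Lipschitz dimension at most $n$ if there exists a Lipschitz light map $X\to\mathbb{R}^n$; the Lipschitz dimension $\dim_L(X)$ is the infimum of such $n$.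
   Formalization: The formal statement assumes in addition that T/M has at least two points (T is not a single point and M ≠ T); if M = T, for example, T/M is a single point and its Lipschitz dimension is 0, not 1. *)

(* Defs.v *)
From HB Require Import structures.
From mathcomp Require Import all_boot all_order all_algebra.
From mathcomp Require Import generic_quotient ring.
From mathcomp Require Import all_classical all_reals all_analysis.

Set Implicit Arguments.
Unset Strict Implicit.
Unset Printing Implicit Defensive.

Import Order.TTheory GRing.Theory Num.Theory.
Import numFieldNormedType.Exports.

Local Open Scope classical_set_scope.
Local Open Scope ring_scope.

Section Trees.
Context {R : realType}.
Implicit Types T : metricType R.

(* [diam set0 = -oo]; this agrees with the convention [diam set0 = 0] in every
   comparison of a diameter with a nonnegative bound. *)
Definition diam T (E : set T) : \bar R :=
  ereal_sup [set (mdist x y)%:E | x in E & y in E].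

(* [A] is homeomorphic to [0, 1], by a homeomorphism sending 0 to [x] and 1 to
   [y]; [g] restricts to the inverse of [f]. *)
Definition jordan_arc T (x y : T) (A : set T) : Prop :=
  exists (f : R -> T) (g : T -> R),
    [/\ {within `[0, 1], continuous f}, {within A, continuous g},
        f @` `[0, 1] = A, {in `[0, 1], cancel f g} & f 0 = x /\ f 1 = y].

Definition locally_connected T : Prop :=
  forall (x : T) (U : set T), open U -> U x ->
    exists V : set T, [/\ open V, connected V, V x & V `<=` U].

Definition is_tree T : Prop :=
  [/\ compact [set: T], connected [set: T], locally_connected T &
      forall x y : T, x <> y -> exists! A : set T, jordan_arc x y A].

Definition bounded_turning T (C : R) : Prop :=
  forall u v : T, exists E : set T,
    [/\ compact E, connected E, E u, E v & (diam E <= (C * mdist u v)%:E)%E].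

Definition doubling T (D : nat) : Prop :=
  forall (x : T) (r : R), 0 < r -> exists s : seq T, (size s <= D)%N /\
    ball x r `<=` \bigcup_(c in [set` s]) ball c (r / 2).

Definition is_qc_tree T : Prop :=
  is_tree T /\
  exists (C : R) (D : nat), [/\ 1 <= C, bounded_turning T C & doubling T D].

End Trees.

Section MetricQuotient.
Context {R : realType} {T : metricType R}.
Local Open Scope quotient_scope.

(* Extended-real valued: the distance to the empty set is [+oo], so that
   collapsing the empty set leaves the metric unchanged. *)
Definition dist_to (E : set T) (a : T) : \bar R :=
  ereal_inf [set (mdist a e)%:E | e in E].

Definition collapse_dist (E : set T) (a b : T) : R :=
  fine (mine (mdist a b)%:E (dist_to E a + dist_to E b))%E.

Definition collapse_rel (E : set T) (x y : T) : bool :=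
  (x == y) || (x \in E) && (y \in E).

Lemma collapse_rel_equiv E : equiv_class_of (collapse_rel E).
Proof.
split=> [x|x y|y x z]; rewrite /collapse_rel.
- by rewrite eqxx.
- by rewrite eq_sym andbC.
- move=> /orP[/eqP-> //|/andP[xE yE]] /orP[/eqP<-|/andP[_ zE]].
  + by rewrite xE yE orbT.
  + by rewrite xE zE orbT.
Qed.

Canonical collapse_equiv (E : set T) := EquivRelPack (collapse_rel_equiv E).

Lemma dist_to_ge0 E a : (0 <= dist_to E a)%E.
Proof. by apply/le_ereal_inf_tmp => _ [e _ <-]; rewrite lee_fin mdist_ge0. Qed.

Lemma dist_to_le E a b : (dist_to E a <= (mdist a b)%:E + dist_to E b)%E.
Proof.
rewrite -leeBlDl//; apply/le_ereal_inf_tmp => _ [e Ee <-].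
rewrite leeBlDl// (@le_trans _ _ (mdist a e)%:E)//.
  by apply: ereal_inf_lbound; exists e.
by rewrite -EFinD lee_fin metric_triangle.
Qed.

Lemma dist_to_in E a : E a -> dist_to E a = 0%E.
Proof.
move=> Ea; apply/eqP; rewrite eq_le dist_to_ge0 andbT.
by apply: ereal_inf_lbound; exists a => //; rewrite mdistxx.
Qed.

Lemma dist_to_closed E a : closed E -> dist_to E a = 0%E -> E a.
Proof.
move=> cE da0; apply: cE => B /nbhs_ballP[e /= e0 aB].
have /ereal_inf_lt[_ [b Eb <-]] : (dist_to E a < e%:E)%E.
  by rewrite da0 lte_fin.
by rewrite lte_fin => abe; exists b; split => //; apply: aB; rewrite ballEmdist.
Qed.

Lemma collapse_distE E a b : ((collapse_dist E a b)%:E =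
  mine (mdist a b)%:E (dist_to E a + dist_to E b))%E.
Proof.
rewrite /collapse_dist fineK// ge0_fin_numE; last first.
  by rewrite le_min lee_fin mdist_ge0 adde_ge0// dist_to_ge0.
by rewrite gt_min ltry.
Qed.

Lemma collapse_distC E a b : collapse_dist E a b = collapse_dist E b a.
Proof. by rewrite /collapse_dist metric_sym addeC. Qed.

Lemma collapse_dist_triangle E b a c :
  collapse_dist E a c <= collapse_dist E a b + collapse_dist E b c.
Proof.
rewrite -lee_fin EFinD !collapse_distE.
set m := mine (mdist a c)%:E _.
have mdle : (m <= (mdist a c)%:E)%E by rewrite /m ge_min lexx.
have mele : (m <= dist_to E a + dist_to E c)%E by rewrite /m ge_min lexx orbT.
case: (leP (mdist a b)%:E) => _; case: (leP (mdist b c)%:E) => _.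
- by rewrite (le_trans mdle)// -EFinD lee_fin metric_triangle.
- by rewrite (le_trans mele)// addeA leeD2r// dist_to_le.
- rewrite (le_trans mele)// -addeA leeD2l// addeC metric_sym.
  exact: dist_to_le.
- rewrite (le_trans mele)// -addeA leeD2l// addeA leeDr//.
  by rewrite adde_ge0// dist_to_ge0.
Qed.

Lemma collapse_dist_eq0 E a b : closed E ->
  collapse_dist E a b = 0 -> collapse_rel E a b.
Proof.
move=> cE; have := collapse_distE E a b; rewrite /collapse_rel => + d0.
rewrite d0; case: leP => [_ [/esym/mdist_positivity ->]|_ /esym/eqP].
  by rewrite eqxx.
rewrite padde_eq0 ?dist_to_ge0// => /andP[/eqP a0 /eqP b0].
by rewrite !mem_set ?orbT//; exact: dist_to_closed.
Qed.

Lemma collapse_dist_rel0 E a b : collapse_rel E a b -> collapse_dist E a b = 0.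
Proof.
move=> ab; apply: EFin_inj; rewrite collapse_distE.
apply/eqP; rewrite eq_le le_min lee_fin mdist_ge0 adde_ge0 ?dist_to_ge0//= andbT.
rewrite ge_min; case/orP : ab => [/eqP ->|/andP[/set_mem aE /set_mem bE]].
  by rewrite mdistxx lexx.
by rewrite !dist_to_in// adde0 lexx orbT.
Qed.

(* Closedness of [E] is what makes [collapse_dist] separate the classes. *)
Definition metric_quotient (E : set T) (cE : closed E) : Type :=
  {eq_quot (collapse_equiv E)}.

Section Instances.
Variables (E : set T) (cE : closed E).
Local Notation Q := (metric_quotient cE).

HB.instance Definition _ := Quotient.copy Q {eq_quot (collapse_equiv E)}.
HB.instance Definition _ := Choice.copy Q {eq_quot (collapse_equiv E)}.

Definition quotient_dist (p q : Q) : R := collapse_dist E (repr p) (repr q).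

Lemma quotient_distxx p : quotient_dist p p = 0.
Proof. by apply: collapse_dist_rel0; rewrite /collapse_rel eqxx. Qed.

Lemma quotient_dist_eq0 p q : quotient_dist p q = 0 -> p = q.
Proof.
move=> /(collapse_dist_eq0 cE) pq; rewrite -[p]reprK -[q]reprK.
exact/eqmodP.
Qed.

Lemma quotient_distC p q : quotient_dist p q = quotient_dist q p.
Proof. exact: collapse_distC. Qed.

Lemma quotient_dist_triangle q p r :
  quotient_dist p r <= quotient_dist p q + quotient_dist q r.
Proof. exact: collapse_dist_triangle. Qed.

HB.instance Definition _ := @isMetric.Build R Q quotient_dist
  quotient_distxx quotient_dist_eq0 quotient_distC quotient_dist_triangle.

(* The metric does not depend on the representatives of the classes. *)
Lemma mdist_pi (a b : T) :
  mdist (\pi_Q a : Q) (\pi_Q b : Q) = collapse_dist E a b.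
Proof.
have repr_rel x : collapse_dist E (repr (\pi_Q x : Q)) x = 0.
  apply: collapse_dist_rel0; apply/eqmodP; exact: reprK.
change (quotient_dist (\pi_Q a) (\pi_Q b) = collapse_dist E a b).
apply/eqP; rewrite eq_le /quotient_dist; apply/andP; split.
- rewrite (le_trans (collapse_dist_triangle E a _ _))// repr_rel add0r.
  rewrite (le_trans (collapse_dist_triangle E b _ _))//.
  by rewrite (collapse_distC E b) repr_rel addr0.
- rewrite (le_trans (collapse_dist_triangle E (repr (\pi_Q a : Q)) _ _))//.
  rewrite (collapse_distC E a) repr_rel add0r.
  rewrite (le_trans (collapse_dist_triangle E (repr (\pi_Q b : Q)) _ _))//.
  by rewrite repr_rel addr0.
Qed.

End Instances.
End MetricQuotient.

(* R^n with its Euclidean metric; the library's metric on ['rV[R]_n] is the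
   sup metric. *)
Definition euclidean (R : realType) (n : nat) : Type := 'rV[R]_n.

Section Euclidean.
Context {R : realType} {n : nat}.
Local Notation V := (euclidean R n).

HB.instance Definition _ := Choice.copy V 'rV[R]_n.

Definition euclidean_dist (x y : V) : R :=
  Num.sqrt (\sum_(i < n) (x ord0 i - y ord0 i) ^+ 2).

Lemma euclidean_distxx x : euclidean_dist x x = 0.
Proof.
rewrite /euclidean_dist big1 ?sqrtr0// => i _.
by rewrite subrr expr0n.
Qed.

Lemma euclidean_dist_eq0 x y : euclidean_dist x y = 0 -> x = y.
Proof.
move/eqP; rewrite sqrtr_eq0 => s0; apply/rowP => i; apply/eqP.
rewrite -subr_eq0 -sqrf_eq0 eq_le sqr_ge0 andbT (le_trans _ s0)//.
rewrite (bigD1 i)//= lerDl sumr_ge0// => j _; exact: sqr_ge0.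
Qed.

Lemma euclidean_distC x y : euclidean_dist x y = euclidean_dist y x.
Proof.
by congr Num.sqrt; apply: eq_bigr => i _; rewrite -[LHS]sqrrN opprB.
Qed.

Lemma cauchy_schwarz_sum (a b : 'I_n -> R) :
  (\sum_i a i * b i) ^+ 2 <= (\sum_i a i ^+ 2) * (\sum_i b i ^+ 2).
Proof.
set A := \sum_i a i ^+ 2; set B := \sum_i b i ^+ 2.
set C := \sum_i a i * b i.
have A0 : 0 <= A by apply: sumr_ge0 => i _; exact: sqr_ge0.
have [A_eq0|A_neq0] := eqVneq A 0.
  suff -> : C = 0 by rewrite expr0n A_eq0 mul0r.
  rewrite /C big1// => i _; suff -> : a i = 0 by rewrite mul0r.
  apply/eqP; rewrite -sqrf_eq0 eq_le sqr_ge0 andbT -A_eq0.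
  rewrite /A (bigD1 i)//= lerDl sumr_ge0// => j _; exact: sqr_ge0.
have A_gt0 : 0 < A by rewrite lt_def A_neq0.
rewrite -subr_ge0 -(pmulr_rge0 _ A_gt0).
have -> : A * (A * B - C ^+ 2) = \sum_i (C * a i - A * b i) ^+ 2.
  have sumE (c d : R) : \sum_i (c * a i - d * b i) ^+ 2 =
      c ^+ 2 * A + (- (c * d) *+ 2) * C + d ^+ 2 * B.
    rewrite !mulr_sumr -!big_split/=; apply: eq_bigr => i _; ring.
  by rewrite sumE; ring.
by apply: sumr_ge0 => i _; exact: sqr_ge0.
Qed.

Lemma euclidean_dist_triangle y x z :
  euclidean_dist x z <= euclidean_dist x y + euclidean_dist y z.
Proof.
set a := fun i => x ord0 i - y ord0 i; set b := fun i => y ord0 i - z ord0 i.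
rewrite /euclidean_dist.
set A := \sum_i (x ord0 i - y ord0 i) ^+ 2.
set B := \sum_i (y ord0 i - z ord0 i) ^+ 2.
have A0 : 0 <= A by apply: sumr_ge0 => i _; exact: sqr_ge0.
have B0 : 0 <= B by apply: sumr_ge0 => i _; exact: sqr_ge0.
rewrite -[leRHS]ger0_norm ?addr_ge0 ?sqrtr_ge0// -sqrtr_sqr ler_sqrt ?sqr_ge0//.
rewrite sqrrD !sqr_sqrtr//.
have -> : \sum_i (x ord0 i - z ord0 i) ^+ 2 = A + (\sum_i a i * b i) *+ 2 + B.
  rewrite -sumrMnl -!big_split/=; apply: eq_bigr => i _.
  by rewrite -sqrrD /a /b addrA subrK.
rewrite lerD2r lerD2l lerMn2r/= -sqrtrM// (le_trans (ler_norm _))//.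
by rewrite -sqrtr_sqr ler_wsqrtr// cauchy_schwarz_sum.
Qed.

HB.instance Definition _ := @isMetric.Build R V euclidean_dist
  euclidean_distxx euclidean_dist_eq0 euclidean_distC euclidean_dist_triangle.

End Euclidean.

Section LipschitzDimension.
Context {R : realType}.
Implicit Types X Y : metricType R.

Definition is_chain X (delta : R) (s : seq X) : bool :=
  sorted (fun x y => mdist x y <= delta) s.

Definition chain_connected X (delta : R) (U : set X) : Prop :=
  forall x y, U x -> U y -> exists s : seq X,
    [/\ is_chain delta s, [set` s] `<=` U, x \in s & y \in s].

Definition chain_component X (delta : R) (A U : set X) : Prop :=
  [/\ U `<=` A, chain_connected delta U &
      forall V : set X, V `<=` A -> chain_connected delta V -> U `<=` V ->
        V = U].

Definition lipschitz_light X Y (f : X -> Y) : Prop :=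
  exists L Q : R, [/\ 0 < L, 0 < Q,
    forall x y, mdist (f x) (f y) <= L * mdist x y &
    forall (r : R) (E : set Y), 0 < r -> (diam E <= r%:E)%E ->
      forall U : set X, chain_component r (f @^-1` E) U ->
        (diam U <= (Q * r)%:E)%E].

Definition lipschitz_dim_le X (n : nat) : Prop :=
  exists f : X -> euclidean R n, lipschitz_light f.

(* Extended-real valued, equal to [+oo] when no [n] is admissible. *)
Definition lipschitz_dim X : \bar R :=
  ereal_inf [set (n%:R)%:E | n in [set n | lipschitz_dim_le X n]].

End LipschitzDimension.

(* Main.v *)
(* Bounded turning makes the arc [x, y] of the tree as small as d(x, y), so a Lipschitz
   F : T -> R is Lipschitz light as soon as it oscillates by at least c d(x, y) on
   [x, y]. Such an F is a zigzag walk along the arcs from a root: at every scale 4^k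
   it moves steadily by one unit, but turns back as long as the point stays close to where
   the current step began. The walk never looks ahead, hence is consistent where arcs
   branch; it is built on finite meshes and then passed to the limit. To collapse M, F is
   folded at the scale of g = d(., M): the folded function vanishes on M, and remains
   light in the quotient metric min(d(x, y), g(x) + g(y)).

   That small continua contain small arcs is where uniqueness of arcs is used: a
   continuum missing a point of the arc between two of its points would be approximated
   by paths, thus by arcs, missing that point. *)
Require Import Defs.
From mathcomp Require Import all_boot all_order all_algebra.
From mathcomp Require Import generic_quotient ring lra zify finmap.
From mathcomp Require Import all_classical all_reals all_analysis.

Set Implicit Arguments.
Unset Strict Implicit.
Unset Printing Implicit Defensive.

Import Order.TTheory GRing.Theory Num.Theory.
Import numFieldNormedType.Exports.

Local Open Scope classical_set_scope.
Local Open Scope ring_scope.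

(** * Ultralimits and metric topology *)

(** Arcs of [T] may have infinite length, and the distance to the root may be constant along an arc,
    as on a circular arc around it; so neither yields a function that is both Lipschitz and
    oscillating on every arc. Counting steps of one scale does oscillate, but along an arc that
    lingers in a small region it drifts without bound, against the Lipschitz condition. The bounce
    cures this drift: a carry to the next scale requires a real displacement, while the bounces
    still oscillate by one unit of their own scale. Both estimates have constants independent of the
    mesh, which permits the passage to the limit. In the quotient, a point at distance g from [M] is
    within g of the collapsed point, so a Lipschitz function vanishing there is at most of order g,
    yet its oscillation over distances below g must survive. Folding with a period comparable to g
    achieves both; since this period changes from point to point, the teeth of the fold must fade in
    and out at a Lipschitz rate. *)

Lemma ultrafilter_nat : exists U : set_system nat,
  UltraFilter U /\ forall N, U [set n | (N <= n)%N].
Proof.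
have [U [UU ooU]] := ultraFilterLemma eventually_filter.
exists U; split; first by [].
move=> N; apply: ooU; by exists N.
Qed.

(** One ultrafilter provides limits at all points of an uncountable space at once, so paths and
    heights converge pointwise with no extraction of subsequences. *)
Lemma ultra_compact_cvg (X : topologicalType) (A : set X)
    (U : set_system nat) (s : nat -> X) :
  UltraFilter U -> compact A -> (forall n, A (s n)) ->
  exists2 l, A l & s n @[n --> U] --> l.
Proof.
move=> UU cA As; have sA : (s n @[n --> U]) A.
  by change (U (s @^-1` A)); apply: filterS filterT => n _; exact: As.
have [l [Al cl]] := cA _ _ sA; exists l => // V nV /=.
rewrite nbhs_simpl/=; have [//|UnV] := in_ultra_setVsetC (s @^-1` V) UU.
have [x [nVx Vx]] := cl (~` V) V UnV nV.
by case: (nVx Vx).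
Qed.

Lemma within_continuous_ballP (R : realType) (Y : pseudoMetricType R)
    (f : R -> Y) (A : set R) :
  {within A, continuous f} <-> forall s, A s -> forall e : R, 0 < e ->
    exists2 del : R, 0 < del &
      forall t, A t -> `|s - t| < del -> ball (f s) e (f t).
Proof.
split=> [/subspace_continuousP fc s As e e0|fc].
  have /(fc _ As) : nbhs (f s) (ball (f s) e) by exact: nbhsx_ballx.
  rewrite nbhs_simpl/= /within/= => /nbhs_ballP[r /= r0 sr].
  by exists r => // t At st; apply: sr.
apply/subspace_continuousP => s As V /nbhs_ballP[e /= e0 sV].
have [r r0 sr] := fc _ As _ e0.
rewrite nbhs_simpl/= /within/=; apply/nbhs_ballP; exists r => //= t st At.
by apply: sV; exact: sr.
Qed.

Section MetricTopology.
Context {R : realType} {T : metricType R}.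
Implicit Types (A E : set T) (x y z : T).

Lemma nbhs_mdistP x (V : set T) :
  nbhs x V <-> exists2 e : R, 0 < e & forall y, mdist x y < e -> V y.
Proof.
split=> [/nbhs_ballP[e /= e0 xV]|[e e0 xV]].
  by exists e => // y xy; apply: xV; rewrite ballEmdist.
by apply/nbhs_ballP; exists e => //= y; rewrite ballEmdist => /xV.
Qed.

Lemma mdist_sub x y z : `|mdist x z - mdist y z| <= mdist x y.
Proof.
rewrite ler_norml; have := metric_triangle x y z.
have := metric_triangle y x z; rewrite (metric_sym y x); lra.
Qed.

Lemma ultra_mdist (A : set T) (U : set_system nat) (s : nat -> T) :
  UltraFilter U -> compact A -> (forall n, A (s n)) ->
  exists2 l, A l & forall e : R, 0 < e -> U [set n | mdist (s n) l < e].
Proof.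
move=> UU cA As; have [l Al sl] := ultra_compact_cvg UU cA As; exists l => //.
move=> e e0; have /sl : nbhs l [set y | mdist y l < e].
  by apply/nbhs_mdistP; exists e => // y; rewrite metric_sym.
by rewrite nbhs_simpl.
Qed.

Lemma within_continuous_mdistP (f : R -> T) (A : set R) :
  {within A, continuous f} <-> forall s, A s -> forall e : R, 0 < e ->
    exists2 del : R, 0 < del &
      forall t, A t -> `|s - t| < del -> mdist (f s) (f t) < e.
Proof.
rewrite within_continuous_ballP; split=> fc s As e e0;
  have [del del0 fdel] := fc s As e e0; exists del => // t At st.
  by have := fdel t At st; rewrite ballEmdist.
by rewrite ballEmdist; exact: fdel.
Qed.

Lemma within_continuous_unif (f : R -> T) (A : set R) : compact A ->
  {within A, continuous f} -> forall e : R, 0 < e -> exists2 del : R, 0 < del &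
    forall s t, A s -> A t -> `|s - t| < del -> mdist (f s) (f t) < e.
Proof.
move=> cA /within_continuous_mdistP fc e e0; apply: contrapT => nd.
have bad (n : nat) : exists p : R * R,
    [/\ A p.1, A p.2, `|p.1 - p.2| < n.+1%:R^-1 & e <= mdist (f p.1) (f p.2)].
  apply: contrapT => np; apply: nd; exists n.+1%:R^-1 => //.
  move=> s t As At st; rewrite ltNge; apply/negP => est.
  by apply: np; exists (s, t).
have [p pP] := choice bad.
have [U [UU ooU]] := ultrafilter_nat.
have p1A n : A (p n).1 by case: (pP n).
have [l Al pl] := ultra_compact_cvg UU cA p1A.
have e20 : 0 < e / 2 by rewrite divr_gt0.
have [r r0 lr] := fc _ Al _ e20.
have r20 : 0 < r / 2 by rewrite divr_gt0.
have /pl : nbhs l [set y | `|l - y| < r / 2] by apply/nbhs_ballP; exists (r / 2).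
rewrite nbhs_simpl/= => Ul.
have [N Nr] : exists N : nat, N.+1%:R^-1 < r / 2.
  have [N _ /(_ N (leqnn N))] := near_infty_natSinv_lt (PosNum r20).
  by exists N.
have [n [/= nl Nn]] := filter_ex (filterI Ul (ooU N)).
have [A1 A2 p12 ep] := pP n.
have nl1 : `|l - (p n).1| < r / 2 := nl.
have nN : n.+1%:R^-1 <= N.+1%:R^-1 :> R.
  by rewrite lef_pV2 ?posrE ?ltr0n// ler_nat ltnS.
have d1 : mdist (f l) (f (p n).1) < e / 2 by apply: lr => //; lra.
have d2 : mdist (f l) (f (p n).2) < e / 2.
  apply: lr => //; have := ler_normD (l - (p n).1) ((p n).1 - (p n).2).
  rewrite addrA subrK.
  have := lt_trans (lt_le_trans p12 nN) Nr; lra.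
have := metric_triangle (f (p n).1) (f l) (f (p n).2).
rewrite (metric_sym (f (p n).1) (f l)); lra.
Qed.

End MetricTopology.

(** * The odometer *)

Section Odometer.
Context {R : realType} {T : metricType R}.
Variable e : R.
Hypothesis e0 : 0 < e.

(* A base-4 counter driven by the points read along an arc: [anchor k] is the point of
   the last carry into level [k], and [digit k] counts the level-[k] steps made from
   [anchor k.+1]. At digit 3, level [k.+1] advances if [anchor k] is [far] from
   [anchor k.+1]; otherwise the digit bounces back to 2. The [height] of the counter
   reads every bounce as a reversal of direction, so that it moves by one at each tick. *)
Record odometer := Odometer { anchor : nat -> T ; digit : nat -> nat }.
Implicit Types S : odometer.

Definition far S k := e * 4 ^+ k <= mdist (anchor S k.+1) (anchor S k).

Fixpoint carry S k :=
  if k is k'.+1 then [&& carry S k', digit S k' == 3%N & far S k'] else true.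

Definition tick S y := Odometer
  (fun k => if carry S k then y else anchor S k)
  (fun k => if ~~ carry S k then digit S k else
            if (digit S k < 3)%N then (digit S k).+1 else
            if far S k then 0%N else 2%N).

(** A digit 3 that is not [far] will bounce to 2, so the lower levels are read backwards, from 3 *
    4^k down to 2 * 4^k. The two anchors involved stay fixed until the next carry into level [k], so
    this is known in advance. *)
Definition heading S k : R := if (digit S k == 3%N) && ~~ far S k then -1 else 1.

(** Passes a height [h] of the levels below [k] through the next [j] levels. Each level acts as an
    isometry of the line, so differences of lower heights survive unchanged. *)
Fixpoint lift_height S k j (h : R) :=
  if j is j'.+1 then
    4 ^+ (k + j') * (digit S (k + j'))%:R +
    heading S (k + j') * lift_height S k j' h
  else h.

Definition height S k := lift_height S 0 k 0.

Definition tame S := forall k, (digit S k <= 3)%N /\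
  mdist (anchor S k.+1) (anchor S k) <= e * 4 ^+ k * (digit S k)%:R.

Definition agree_from k S S' :=
  forall i, (k <= i)%N -> anchor S' i = anchor S i /\ digit S' i = digit S i.

Lemma carryW S i k : (i <= k)%N -> carry S k -> carry S i.
Proof.
elim: k => [|k IH]; first by rewrite leqn0 => /eqP ->.
by rewrite leq_eqVlt => /predU1P[->//|ik] /= /and3P[ck _ _]; exact: IH.
Qed.

Lemma lift_height_inner S k j h : lift_height S k j.+1 h =
  lift_height S k.+1 j (4 ^+ k * (digit S k)%:R + heading S k * h).
Proof.
elim: j => [|j IH] /=; first by rewrite addn0.
by rewrite -IH /= addnS.
Qed.

Lemma height_lift S k j : height S (k + j) = lift_height S k j (height S k).
Proof. by elim: j => [|j IH]; rewrite ?addn0// addnS /height /= add0n -IH. Qed.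

Lemma lift_height_dist S k j a b :
  `|lift_height S k j a - lift_height S k j b| = `|a - b|.
Proof.
elim: j => //= j IH; rewrite opprD addrACA subrr add0r -mulrBr normrM IH.
by rewrite /heading; case: ifP => _; rewrite ?normrN1 ?normr1 mul1r.
Qed.

Lemma agree_lift_height S S' k j h : agree_from k S S' ->
  lift_height S' k j h = lift_height S k j h.
Proof.
move=> SS'; elim: j => //= j ->; rewrite /heading /far.
have [-> ->] := SS' (k + j)%N (leq_addr _ _).
by have [-> _] := SS' (k + j).+1 (leqW (leq_addr _ _)).
Qed.

Lemma height_bounds S : tame S -> forall k, 0 <= height S k <= 4 ^+ k - 1.
Proof.
move=> tS; elim=> [|k /andP[h0 hk]]; first by rewrite /height /= expr0; lra.
rewrite /height /= add0n -/(height S k) /heading exprS.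
have p1 : 1 <= 4 ^+ k :> R by rewrite exprn_ege1//; lra.
have [+ _] := tS k; case: (digit S k) => [|[|[|[|//]]]] _ /=;
  case: (far S k) => /=; nra.
Qed.

Lemma anchor_dist S : tame S ->
  forall k, mdist (anchor S k) (anchor S 0) <= e * (4 ^+ k - 1).
Proof.
move=> tS; elim=> [|k IH]; first by rewrite mdistxx expr0; nra.
have [dk ak] := tS k; have := metric_triangle (anchor S k.+1) (anchor S k) (anchor S 0).
have dk3 : (digit S k)%:R <= 3 :> R by rewrite ler_nat.
have p1 : 0 < e * 4 ^+ k by rewrite mulr_gt0// exprn_gt0.
rewrite exprS; nra.
Qed.

Lemma anchor_step S y : tame S -> mdist (anchor S 0) y <= e ->
  forall k, mdist (anchor S k) y <= e * 4 ^+ k.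
Proof.
move=> tS Sy k; have := anchor_dist tS k.
have := metric_triangle (anchor S k) (anchor S 0) y; lra.
Qed.

(** This invariant is why a bounce goes to 2: an anchor that is not [far] lies within e * 4^k of the
    one above, and the step from it to [y] adds at most another e * 4^k. *)
Lemma tame_tick S y : tame S -> mdist (anchor S 0) y <= e -> tame (tick S y).
Proof.
move=> tS Sy k; have [dk ak] := tS k; have ek := anchor_step tS Sy k.
have p1 : 0 < e * 4 ^+ k by rewrite mulr_gt0// exprn_gt0.
rewrite /tick; cbn [anchor digit].
have -> : carry S k.+1 = [&& carry S k, digit S k == 3%N & far S k] by [].
case: (carry S k) => //=.
have tri := metric_triangle (anchor S k.+1) (anchor S k) y.
case: ltnP => d3.
  have -> /= : (digit S k == 3%N) = false by lia.
  by split => //; rewrite -[(digit S k).+1]addn1 natrD; lra.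
have /eqP d3E : digit S k == 3%N by lia.
rewrite d3E eqxx /=; case: ifP => fS; first by rewrite mdistxx mulr0.
split=> //; move: fS; rewrite /far => /negbT; rewrite -ltNge; lra.
Qed.

Lemma height_tick_carry S y k : carry S k -> height (tick S y) k = 0.
Proof.
elim: k => // k IH cS; have ck := carryW (leqnSn k) cS.
rewrite /height /= add0n -/(height _ k) IH// mulr0 ck /=.
by case/and3P: cS => _ /eqP -> -> /=; rewrite mulr0 addr0.
Qed.

Lemma agree_tick S y k : ~~ carry S k -> agree_from k S (tick S y).
Proof.
move=> nck i ki /=; have -> : carry S i = false; last by [].
by apply/negbTE; apply: contra nck; exact: carryW.
Qed.

(** Continuity of the height across a carry: the lower height, due to reach 4^k, is reset to 0, and
    the digits make up for it. A digit below 3 grows by one; at 3 and [far] the excess passes to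
    level [k.+1]; at 3 and not [far], 3 * 4^k - 4^k is the new 2 * 4^k. *)
Lemma lift_tick_carry S y k j :
  (forall i, digit S i <= 3)%N -> carry S k -> ~~ carry S (k + j) ->
  lift_height (tick S y) k j 0 = lift_height S k j (4 ^+ k).
Proof.
move=> d3; elim: j k => [|j IH] k ck; first by rewrite addn0 ck.
rewrite addnS -addSn => nc; rewrite !lift_height_inner mulr0 addr0.
have -> : digit (tick S y) k = if (digit S k < 3)%N then (digit S k).+1 else
            if far S k then 0%N else 2%N by rewrite /= ck.
have [ckS|nckS] := boolP (carry S k.+1).
  case/and3P: (ckS) => _ /eqP -> fk; rewrite fk /= mulr0 IH//.
  by congr lift_height; rewrite /heading fk andbF exprS; ring.
rewrite (agree_lift_height _ _ (agree_tick y nckS)); congr lift_height.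
move: nckS; rewrite /= ck /= /heading; have := d3 k.
case: (digit S k) => [|[|[|[|//]]]] _ /=; try by move=> _; ring.
by move=> /negbTE -> /=; ring.
Qed.

(* Close points trigger at most one carry into level [k.+1]: after it the anchors at
   levels [k] and [k.+1] are among the points read, hence never [far] apart. *)
Lemma foldl_tick_near S (s : seq T) k j :
  (forall i, digit S i <= 3)%N ->
  {in s &, forall x y, mdist x y < e * 4 ^+ k} ->
  (forall S', ~~ carry S' (k.+1 + j)) ->
  (forall i, digit (foldl tick S s) i <= 3)%N /\
  (agree_from k.+1 S (foldl tick S s) \/
   [/\ anchor (foldl tick S s) k.+1 \in s, anchor (foldl tick S s) k \in s &
       lift_height (foldl tick S s) k.+1 j 0 = lift_height S k.+1 j (4 ^+ k.+1)]).
Proof.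
move=> d3 + nc; elim/last_ind: s => [|s y IH] near; first by split=> //; left.
rewrite foldl_rcons; set S' := foldl tick S s in IH *.
have {}near1 : {in s &, forall x y, mdist x y < e * 4 ^+ k}.
  by move=> x z xs zs; apply: near; rewrite mem_rcons inE ?xs ?zs orbT.
have [d3' IH'] := IH near1; split=> [i /=|].
  by have := d3' i; case: (carry S' i) => //=; case: ltnP => // _; case: ifP.
have ys : y \in rcons s y by rewrite mem_rcons inE eqxx.
have sS x : x \in s -> x \in rcons s y by rewrite mem_rcons inE => ->; rewrite orbT.
case: IH' => [ag|[a1 a0 h1]].
- have [cS|ncS] := boolP (carry S' k.+1).
    right; have ck := carryW (leqnSn k) cS.
    have -> : anchor (tick S' y) k.+1 = y by rewrite [LHS]/= ifT.
    have -> : anchor (tick S' y) k = y by rewrite /= ck.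
    by split=> //; rewrite lift_tick_carry// (agree_lift_height _ _ ag).
  left=> i ki; have [-> ->] := agree_tick y ncS ki; exact: ag.
- have ncS : ~~ carry S' k.+1.
    by apply/negP => /= /and3P[_ _]; rewrite /far leNgt near1.
  right; rewrite (agree_lift_height _ _ (agree_tick y ncS)); split => //.
    by rewrite [anchor _ _]/= ifN; [exact: sS|].
  by rewrite /=; case: (carry S' k) => //; exact: sS.
Qed.

(** The comparison value depends on [S] only, so two branches leaving the same state can both be
    compared with it. One 4^k.+1 pays for the single possible carry into level [k.+1], the other for
    the lower height. *)
Lemma height_near S (s : seq T) k j : tame S -> tame (foldl tick S s) ->
  {in s &, forall x y, mdist x y < e * 4 ^+ k} ->
  (forall S', ~~ carry S' (k.+1 + j)) ->
  `|height (foldl tick S s) (k.+1 + j) - lift_height S k.+1 j 0| <= 2 * 4 ^+ k.+1.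
Proof.
move=> tS tS' near nc.
have [_] := foldl_tick_near (fun i => proj1 (tS i)) near nc.
set S' := foldl tick S s in tS' *.
have /andP[h0 hk] := height_bounds tS' k.+1.
have h4 : `|height S' k.+1| <= 4 ^+ k.+1 by rewrite ger0_norm; lra.
have p4 : 0 <= 4 ^+ k.+1 :> R by rewrite exprn_ge0.
rewrite height_lift => -[ag|[_ _ h1]].
  by rewrite (agree_lift_height _ _ ag) lift_height_dist subr0; lra.
have := lift_height_dist S' k.+1 j (height S' k.+1) 0.
have := lift_height_dist S k.+1 j (4 ^+ k.+1) 0; rewrite !subr0 -h1.
rewrite (@ger0_norm _ (4 ^+ k.+1))// => h2 h3.
rewrite -(subrK (lift_height S' k.+1 j 0) (lift_height S' _ _ (height _ _))) -addrA.
apply: le_trans (ler_normD _ _) _; rewrite h3 h2; lra.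
Qed.

Lemma tame_foldl S (s : seq T) : tame S ->
  path (fun x y => mdist x y <= e) (anchor S 0) s ->
  tame (foldl tick S s) /\ anchor (foldl tick S s) 0 = last (anchor S 0) s.
Proof.
elim: s S => //= y s IH S tS /andP[Sy ys].
exact: (IH (tick S y) (tame_tick tS Sy) ys).
Qed.

Definition spread S (s : seq T) k j := exists s1 s2 t1 t2 : seq T,
  [/\ s = s1 ++ t1, s = s2 ++ t2 & 4 ^+ k <=
    `|height (foldl tick S s1) (k + j) - height (foldl tick S s2) (k + j)|].

(** The cases correspond to two carries into level [k], none, or exactly one. The lower height is 0
    right after each carry, so by [lift_tick_carry] two consecutive carries are 4^k apart in
    height. *)
Lemma foldl_tick_spread S (s : seq T) k j : tame S ->
  path (fun x y => mdist x y <= e) (anchor S 0) s ->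
  (forall S', ~~ carry S' (k + j)) ->
  [\/ spread S s k j, agree_from k S (foldl tick S s) |
    exists s1 t1 : seq T, [/\ s = s1 ++ t1, height (foldl tick S s1) k = 0,
      agree_from k (foldl tick S s1) (foldl tick S s) &
      mdist (anchor S k) (anchor (foldl tick S s) k) <= e * 4 ^+ k]].
Proof.
move=> tS + nc; elim/last_ind: s => [|s y IH]; first by move=> _; apply: Or32.
rewrite rcons_path => /andP[ps sy]; have [tS' lS'] := tame_foldl tS ps.
rewrite -lS' in sy; rewrite foldl_rcons; set S' := foldl tick S s in IH tS' sy lS' *.
have p4 : 0 <= 4 ^+ k :> R by rewrite exprn_ge0.
have agT A B C : agree_from k A B -> agree_from k B C -> agree_from k A C.
  by move=> AB BC i ki; have [-> ->] := BC i ki; exact: AB.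
case: (IH ps) => [[s1 [s2 [t1 [t2 [E1 E2 h]]]]]|ag|[s1 [t1 [E1 h1 ag a1]]]].
- apply: Or31; exists s1, s2, (rcons t1 y), (rcons t2 y).
  by rewrite -!rcons_cat -E1 -E2.
- have [cS|ncS] := boolP (carry S' k); last first.
    by apply: Or32; exact: agT (agree_tick y ncS).
  apply: Or33; exists (rcons s y), [::]; rewrite cats0 foldl_rcons.
  split=> //; first exact: height_tick_carry.
  rewrite /= cS; have [<- _] := ag _ (leqnn k); exact: anchor_step.
- have [cS|ncS] := boolP (carry S' k); last first.
    apply: Or33; exists s1, (rcons t1 y); rewrite -rcons_cat -E1; split=> //.
      exact: agT (agree_tick y ncS).
    by have [-> _] := agree_tick y ncS (leqnn k).
  apply: Or31; exists (rcons s y), s1, [::], (rcons t1 y).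
  rewrite -rcons_cat -E1 cats0; split=> //.
  rewrite foldl_rcons -/S' !height_lift h1 height_tick_carry// lift_tick_carry//.
  + rewrite (agree_lift_height _ _ ag) lift_height_dist subr0 ger0_norm//.
  + by move=> i; have [] := tS' i.
Qed.

(** With at most one carry into level [k], its anchor moves by at most e * 4^k, and at either end
    the current point is within e * 4^k of it: hence the factor 3. *)
Lemma height_spread S (s : seq T) k j : tame S ->
  path (fun x y => mdist x y <= e) (anchor S 0) s ->
  (forall S', ~~ carry S' (k + j)) ->
  spread S s k j \/
  mdist (anchor S 0) (last (anchor S 0) s) <= 3 * (e * 4 ^+ k).
Proof.
move=> tS ps nc; have [tS' <-] := tame_foldl tS ps.
have p4 : 0 < e * 4 ^+ k by rewrite mulr_gt0// exprn_gt0.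
have aS := anchor_dist tS k; have aS' := anchor_dist tS' k; have e1 := e0.
have t1 := metric_triangle (anchor S 0) (anchor S k) (anchor (foldl tick S s) 0).
have t2 := metric_triangle (anchor S k) (anchor (foldl tick S s) k)
  (anchor (foldl tick S s) 0).
rewrite (metric_sym (anchor S 0) (anchor S k)) in t1.
case: (foldl_tick_spread tS ps nc) => [sp|ag|[s1 [u1 [_ _ _ h]]]]; first by left.
- right; have [a1 _] := ag _ (leqnn k); rewrite a1 mdistxx in t2.
  rewrite a1 in aS'; lra.
- right; lra.
Qed.

(** Nothing is [far] at a scale above the diameter: the counter never overflows, and finitely many
    levels suffice to read its height. *)
Lemma carry_bounded k S : (forall x y : T, mdist x y < e * 4 ^+ k) ->
  ~~ carry S k.+1.
Proof. by move=> dT; apply/negP => /= /and3P[_ _]; rewrite /far leNgt dT. Qed.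

Definition start (p : T) := Odometer (fun=> p) (fun=> 0%N).

Lemma tame_start p : tame (start p).
Proof. by move=> k; rewrite /= mdistxx mulr0. Qed.

End Odometer.

(** * The dyadic comb *)

Section DyadicComb.
Context {R : realType}.
Variable B : R.
Hypothesis B0 : 0 < B.
Implicit Types (t h : R) (k : nat) (n m : int).

Definition mesh k : R := B / 2 ^+ k.

(* [comb _ h] is a zigzag of slopes 1 and -1 and period about [h]: the spikes at the
   multiples of [mesh k] fade out as [h] grows past [mesh k]. *)
Definition spike t h k n : R := `|t - n%:~R * mesh k| + Num.max 0 (h - mesh k).

Definition comb t h : R := inf [set spike t h p.1 p.2 | p in [set: nat * int]].

Lemma mesh_gt0 k : 0 < mesh k.
Proof. by rewrite divr_gt0// exprn_gt0. Qed.

Lemma meshS k : mesh k = 2 * mesh k.+1.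
Proof. by rewrite /mesh exprS; field; apply: expf_neq0. Qed.

Lemma meshD k j : mesh k = 2 ^+ j * mesh (k + j).
Proof. by rewrite /mesh exprD; field; rewrite !expf_neq0. Qed.

Lemma spike_ge0 t h k n : 0 <= spike t h k n.
Proof. by rewrite addr_ge0// le_max lexx. Qed.

Lemma comb_le t h k n : comb t h <= spike t h k n.
Proof.
apply: ge_inf; last by exists (k, n).
by exists 0 => _ [p _ <-]; exact: spike_ge0.
Qed.

Lemma comb_ge t h (c : R) : (forall k n, c <= spike t h k n) -> c <= comb t h.
Proof.
move=> cs; apply: lb_le_inf; first by exists (spike t h 0 0), (0%N, 0).
by move=> _ [p _ <-]; exact: cs.
Qed.

Lemma comb_ge0 t h : 0 <= comb t h.
Proof. by apply: comb_ge => k n; exact: spike_ge0. Qed.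

Lemma comb_lip t t' h h' : `|comb t h - comb t' h'| <= `|t - t'| + `|h - h'|.
Proof.
wlog suff H : t t' h h' / comb t h - comb t' h' <= `|t - t'| + `|h - h'|.
  rewrite ler_norml H andbT lerNl opprB (le_trans (H _ _ _ _))//.
  by rewrite (distrC t') (distrC h').
rewrite lerBlDl addrC -lerBlDl; apply: comb_ge => k n.
rewrite lerBlDl (le_trans (comb_le t h k n))// /spike.
have : `|t - n%:~R * mesh k| <= `|t - t'| + `|t' - n%:~R * mesh k|.
  by rewrite (le_trans _ (ler_normD _ _))// addrA subrK.
have m1 : 0 <= Num.max 0 (h' - mesh k) by rewrite le_max lexx.
have m2 : h' - mesh k <= Num.max 0 (h' - mesh k) by rewrite le_max lexx orbT.
have h1 := ler_norm (h - h'); have h2 := normr_ge0 (h - h').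
have : Num.max 0 (h - mesh k) <= `|h - h'| + Num.max 0 (h' - mesh k).
  by rewrite ge_max; apply/andP; split; lra.
lra.
Qed.

Lemma mesh_scale h : 0 < h <= B ->
  exists k, [/\ mesh k <= h, h <= 2 * mesh k & (0 < k)%N \/ h = mesh k].
Proof.
move=> /andP[h0 hB].
have ex : exists k, mesh k <= h.
  have [k /= Bk] : exists k : nat, B / h < k%:R.
    by exists (Num.truncn (B / h)).+1; rewrite truncnS_gt// divr_ge0// ltW.
  exists k; rewrite /mesh ler_pdivrMr ?exprn_gt0// mulrC -ler_pdivrMr//.
  rewrite (le_trans (ltW Bk))// -natrX ler_nat; exact/ltnW/ltn_expl.
case: (ex_minnP ex) => k hk min; exists k; split=> //.
- case: k hk min => [|k] hk min; last first.
    rewrite -meshS leNgt; apply/negP => /ltW /min; lia.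
  by have := B0; move: hk; rewrite /mesh expr0 divr1; lra.
- case: k hk min => [|k] hk min; [right|by left].
  by move: hk; rewrite /mesh expr0 divr1 => hk; lra.
Qed.

Lemma floor_mesh t k : (Num.floor (t / mesh k))%:~R * mesh k <= t <
  (Num.floor (t / mesh k) + 1)%:~R * mesh k.
Proof.
have m0 := mesh_gt0 k.
by rewrite -ler_pdivlMr// -ltr_pdivrMr// floor_le_tmp floorD1_gt.
Qed.

(** This makes the folded height vanish at a linear rate near the collapsed set. A mesh of size
    between h and 2h has spikes without penalty; h = 0 follows by continuity. *)
Lemma comb_le2 t h : 0 <= h <= B -> comb t h <= 2 * h.
Proof.
have pos h' : 0 < h' <= B -> comb t h' <= 2 * h'.
  move=> hB; have [j /andP[hj jh]] : exists j, h' <= mesh j <= 2 * h'.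
    have [[|k] [kh hk kpos]] := mesh_scale hB; first by exists 0%N; case: kpos => //; lra.
    by exists k; rewrite meshS; lra.
  have m0 := mesh_gt0 j; have /andP[f1 f2] := floor_mesh t j.
  rewrite (le_trans (comb_le t h' j (Num.floor (t / mesh j))))// /spike.
  rewrite max_l ?subr_le0// ger0_norm ?subr_ge0//.
  by rewrite intrD in f2; lra.
move=> /andP[h0 hB]; have [h1|h1] := ltP 0 h; first by apply: pos; rewrite h1.
have -> : h = 0 by lra.
rewrite mulr0; apply/ler_addgt0Pr => e e0; rewrite add0r.
have b0 := B0.
pose h' := Num.min B (e / 3); have h'0 : 0 < h' by rewrite lt_min b0 divr_gt0.
have h'B : h' <= B by rewrite ge_min lexx.
have h'e : h' <= e / 3 by rewrite ge_min lexx orbT.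
have := pos h'; rewrite h'0 h'B => /(_ isT).
have := comb_lip t t 0 h'; rewrite subrr normr0 sub0r normrN add0r (ger0_norm (ltW h'0)).
have := ler_norm (comb t 0 - comb t h'); lra.
Qed.

(* On a cell [[n P, (n + 1) P]] of the mesh [P] comparable to [h], all other spikes
   are dominated, so [comb] is a tent there. *)
Lemma comb_cell h : 0 < h <= B -> exists k, h <= 2 * mesh k /\
  forall n, exists a b : R, forall t, n%:~R * mesh k <= t <= (n + 1)%:~R * mesh k ->
    comb t h = Num.min (t - a) (b - t).
Proof.
move=> hB; have [k [kh hk kpos]] := mesh_scale hB; exists k; split=> // n.
set P := mesh k in kh hk kpos *; have P0 : 0 < P := mesh_gt0 k.
(* Even multiples of [P] belong to the next coarser mesh, of size at least h, whose spikes carry no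
   penalty; odd ones pay h - P. At [k = 0] there is no coarser mesh, but then h = P and both values
   are 0. *)
pose pen m : R := if (2 %| m)%Z then 0 else h - P.
have pen0 m : 0 <= pen m <= P by rewrite /pen; case: ifP => _; lra.
exists (n%:~R * P - pen n), ((n + 1)%:~R * P + pen (n + 1)) => t /andP[nt tn].
have le_pen m : comb t h <= `|t - m%:~R * P| + pen m.
  rewrite /pen; case: ifPn => [/dvdzP[m' mE]|_]; last first.
    by rewrite (le_trans (comb_le t h k m))// /spike max_r ?subr_ge0.
  case: k @P kh hk kpos P0 @pen pen0 nt tn => [|k] P kh hk kpos P0 pen pen0 nt tn.
    rewrite (le_trans (comb_le t h 0 m))// /spike max_l//.
    by case: kpos => // ->; rewrite subrr.
  rewrite (le_trans (comb_le t h k m'))// /spike meshS -/P max_l ?subr_le0//.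
  by rewrite mE intrM mulrA.
(* Spikes of coarser meshes sit at even multiples of [P]. A finer spike is rounded down to a
   multiple of [P]: the displacement is at most [P - mesh k'], which is exactly the excess of its
   penalty over h - P. *)
have ge_pen k' n' : exists m, `|t - m%:~R * P| + pen m <= spike t h k' n'.
  have [k'k|kk'] := ltnP k' k.
    exists (n' * 2 ^+ (k - k')); rewrite /pen.
    have -> : (2 %| n' * 2 ^+ (k - k'))%Z.
      have : (0 < k - k')%N by lia.
      by case: (k - k')%N => // d _; rewrite exprS mulrCA dvdz_mulr.
    rewrite addr0 /spike (meshD k' (k - k')) subnKC 1?ltnW// -/P.
    by rewrite intrM rmorphXn/= -mulrA lerDl le_max lexx.
  set d := (k' - k)%N; have k'E : (k + d)%N = k' by rewrite subnKC.
  exists (n' %/ 2 ^+ d)%Z; have := divz_eq n' (2 ^+ d).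
  set m := (n' %/ 2 ^+ d)%Z; set r := (n' %% 2 ^+ d)%Z => n'E.
  have d0 : 0 < 2 ^+ d :> int by rewrite exprn_gt0.
  have r0 : 0 <= r by rewrite modz_ge0// gt_eqF.
  have rd : r + 1 <= 2 ^+ d by rewrite lezD1 ltz_pmod.
  have PE : P = 2 ^+ d * mesh k' by rewrite -k'E -meshD.
  have m0 := mesh_gt0 k'.
  have r0' : 0 <= r%:~R :> R by rewrite ler0z.
  have rd' : r%:~R + 1 <= 2 ^+ d :> R.
    by move: rd; rewrite -(ler_int R) intrD rmorphXn.
  have e1 : n'%:~R * mesh k' - m%:~R * P = r%:~R * mesh k'.
    by rewrite n'E intrD intrM rmorphXn/= PE; ring.
  have k'P : mesh k' <= P by nra.
  have tri : `|t - m%:~R * P| <= `|t - n'%:~R * mesh k'| + r%:~R * mesh k'.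
    rewrite -[X in _ <= _ + X]ger0_norm; last by rewrite mulr_ge0// ltW.
    by rewrite -e1 (le_trans _ (ler_normD _ _))// addrA subrK.
  rewrite /spike max_r; last lra.
  have penm : pen m <= h - P by rewrite /pen; case: ifP => _; lra.
  nra.
apply/eqP; rewrite eq_le; apply/andP; split.
  rewrite le_min; apply/andP; split.
    by have := le_pen n; rewrite ger0_norm ?subr_ge0//; lra.
  by have := le_pen (n + 1); rewrite ler0_norm ?subr_le0//; lra.
apply: comb_ge => k' n'; have [m] := ge_pen k' n'; apply: le_trans.
have /andP[pm0 pmP] := pen0 m; have /andP[pn0 pnP] := pen0 n.
have /andP[pn0' pnP'] := pen0 (n + 1).
have ltP' (i j : int) : (i < j)%R -> i%:~R * P + P <= j%:~R * P.
  by rewrite -lezD1 -(ler_int R) intrD => ij; nra.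
rewrite ge_min; have [->|mn] := eqVneq m n.
  by rewrite ger0_norm ?subr_ge0//; apply/orP; left; lra.
have [->|mn1] := eqVneq m (n + 1).
  by rewrite ler0_norm ?subr_le0//; apply/orP; right; lra.
have [/ltP' lt|] := ltP m n.
  have := ler_norm (t - m%:~R * P); apply/implyP.
  by apply/implyP => tm; apply/orP; left; lra.
rewrite le_eqVlt eq_sym (negbTE mn)/= -lezD1 le_eqVlt eq_sym (negbTE mn1)/= => /ltP' lt.
have := ler_norm (m%:~R * P - t); rewrite distrC => tm; apply/orP; right; lra.
Qed.

(** An interval of length l at most [P] meets at most two consecutive cells, so half of it lies in
    one cell. There the comb is a tent, and one of the two halves of that piece, of length at least
    l / 4, lies on a single side of the tent. *)
Lemma comb_light h (u v : R) : 0 < h <= B -> u <= v ->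
  exists t1 t2, [/\ u <= t1 <= v, u <= t2 <= v &
    Num.min (v - u) (h / 2) / 4 <= `|comb t1 h - comb t2 h|].
Proof.
move=> hB uv; have [k [hk cell]] := comb_cell hB.
have P0 := mesh_gt0 k; set P := mesh k in hk cell P0.
have h0 : 0 < h by case/andP: hB.
set l := Num.min _ _; have l0 : 0 <= l by rewrite le_min subr_ge0 uv divr_ge0// ltW.
have luv : l <= v - u by rewrite ge_min lexx.
have lP : l <= P by rewrite ge_min; apply/orP; right; lra.
have tent x y a b : u <= x -> x + l / 2 <= y -> y <= v ->
    (forall t, x <= t <= y -> comb t h = Num.min (t - a) (b - t)) ->
    exists t1 t2, [/\ u <= t1 <= v, u <= t2 <= v & l / 4 <= `|comb t1 h - comb t2 h|].
  move=> ux xy yv E; set w := (x + y) / 2.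
  have Ex := E x; have Ew := E w; have Ey := E y.
  have [wab|wab] := leP (w - a) (b - w).
    exists w, x; split; [by rewrite /w; lra|lra|].
    rewrite Ew ?Ex; try (rewrite /w; lra).
    rewrite !min_l; try (move: wab; rewrite /w; lra).
    by apply: le_trans (ler_norm _); rewrite /w; lra.
  exists w, y; split; [by rewrite /w; lra|lra|].
  rewrite Ew ?Ey; try (rewrite /w; lra).
  rewrite !min_r; try (move: wab; rewrite /w; lra).
  by apply: le_trans (ler_norm _); rewrite /w; lra.
have /andP[f1 f2] := floor_mesh u k; rewrite -/P in f1 f2.
set n := Num.floor _ in f1 f2.
have [c1|c1] := leP (u + l / 2) ((n + 1)%:~R * P).
  have [a [b E]] := cell n; apply: (tent u (u + l / 2) a b) => //; try lra.
  by move=> t ?; apply: E; lra.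
have [a [b E]] := cell (n + 1).
apply: (tent ((n + 1)%:~R * P) (u + l) a b) => //; try lra.
by move=> t ?; apply: E; rewrite (intrD _ (n + 1)); lra.
Qed.

End DyadicComb.

(** * Paths in spaces of bounded turning *)

Section Chains.
Context {R : realType} {T : metricType R}.
Implicit Types (A E : set T) (x y z : T).

Lemma open_mdist_ball x (e : R) : open [set y | mdist x y < e].
Proof.
rewrite openE => y /= xy; apply/nbhs_mdistP; exists (e - mdist x y).
  by rewrite subr_gt0.
by move=> z yz; have /= := metric_triangle x y z; lra.
Qed.

Lemma compact_net (e : R) : compact [set: T] -> 0 < e ->
  exists s : seq T, forall x, exists2 c, c \in s & mdist c x < e.
Proof.
move=> cT e0; apply: contrapT => nnet.
pose F (A : set T) := exists s : seq T, forall x, (forall c, c \in s -> e <= mdist c x) -> A x.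
have FF : ProperFilter F.
  split.
    move=> [s sP]; apply: nnet; exists s => x; apply: contrapT => nx.
    apply: (sP x) => c cs; rewrite leNgt; apply/negP => cx.
    by apply: nx; exists c.
  split; first by exists [::].
    move=> A B [s sA] [s' s'B]; exists (s ++ s') => x xs; split.
      by apply: sA => c cs; apply: xs; rewrite mem_cat cs.
    by apply: s'B => c cs; apply: xs; rewrite mem_cat cs orbT.
  by move=> A B AB [s sA]; exists s => x xs; exact/AB/sA.
have FT : F setT by exists [::].
have [p [_ clp]] := cT _ FF FT.
have Fp : F [set x | e <= mdist p x].
  by exists [:: p] => x; apply; rewrite inE.
have np : nbhs p [set x | mdist p x < e] by apply/nbhs_mdistP; exists e.
by have [x [/=]] := clp _ _ Fp np; rewrite leNgt => /negP.
Qed.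

Lemma connected_chain_ind E (P : T -> Prop) (e : R) : connected E -> 0 < e ->
  (forall x y, E x -> E y -> mdist x y < e -> P x -> P y) ->
  forall x y, E x -> E y -> P x -> P y.
Proof.
move=> cE e0 step x y Ex Ey Px.
have : E `&` P = E.
  apply: cE; first by exists x.
  - exists (\bigcup_(z in E `&` P) [set w | mdist z w < e]).
      by apply: bigcup_open => z _; exact: open_mdist_ball.
    apply/seteqP; split=> w [Ew].
      by move=> Pw; split=> //; exists w => //=; rewrite mdistxx.
    by move=> [z [Ez Pz] /= zw]; split=> //; exact: step zw Pz.
  - exists (~` \bigcup_(z in E `\` P) [set w | mdist z w < e]).
      by apply: open_closedC; apply: bigcup_open => z _; exact: open_mdist_ball.
    apply/seteqP; split=> w [Ew].
      move=> Pw; split=> // -[z [Ez nPz] /= zw]; apply: nPz.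
      by apply: step Pw => //; rewrite metric_sym.
    move=> nw; split=> //; apply: contrapT => nPw; apply: nw.
    by exists w => //=; rewrite mdistxx.
by move=> EPE; move: Ey; rewrite -EPE => -[].
Qed.

Definition mdist_le (e : R) : rel T := fun x y => mdist x y <= e.

(** Apart from its first point, the chain runs in a fixed finite net near [E] rather than in [E];
    once shortened it has no repetition, so its length is bounded by the size of the net, uniformly
    in [E]. *)
Lemma connected_chain (e : R) : compact [set: T] -> 0 < e -> exists m : nat,
  forall E, connected E -> forall x y, E x -> E y -> exists c : nat -> T,
    [/\ c 0%N = x, forall i, (m < i)%N -> c i = y,
        forall i, mdist (c i) (c i.+1) <= e &
        forall i, exists2 w, E w & mdist (c i) w <= e].
Proof.
move=> cT e0; have e30 : 0 < e / 3 by rewrite divr_gt0.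
have [s sP] := compact_net cT e30; exists (size s) => E cE x y Ex Ey.
pose P z := exists p : seq T, [/\ path (mdist_le e) x p,
  (forall c, c \in p -> c \in s /\ exists2 w, E w & mdist c w <= e) &
  mdist (last x p) z <= e / 3].
have [p [xp ps py]] : P y.
  apply: (connected_chain_ind cE e30 _ Ex Ey); last first.
    by exists [::]; split=> //=; rewrite mdistxx ltW.
  move=> z w Ez Ew zw [p [xp ps pz]]; have [c cs cw] := sP w.
  have t1 := metric_triangle (last x p) z c.
  have t2 := metric_triangle z w c; rewrite (metric_sym w c) in t2.
  exists (rcons p c); split.
  - by rewrite rcons_path xp /mdist_le; lra.
  - move=> a; rewrite mem_rcons inE => /predU1P[->|/ps//].
    by split=> //; exists w => //; lra.
  - by rewrite last_rcons; lra.
move: py; case/shortenP : xp => q xq uq qp qy.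
(* The default value [y] keeps the chain at its end point after its last index. *)
exists (nth y (x :: q)); split=> //.
- move=> i si; rewrite nth_default//= (leq_trans _ si)// ltnS.
  have /andP[_ uq'] := uq; apply: uniq_leq_size => // c cq.
  by have [] := ps c (qp _ cq).
- move=> i; have [iq|] := ltnP i (size q).
    exact: (pathP y xq).
  rewrite leq_eqVlt => /predU1P[<-|iq].
    by rewrite -last_nth nth_default//; lra.
  by rewrite !nth_default ?mdistxx ?ltW//= ltnW.
- case=> [|i] /=; first by exists x => //; rewrite mdistxx ltW.
  have [iq|iq] := ltnP i (size q); last first.
    by rewrite nth_default//; exists y => //; rewrite mdistxx ltW.
  by have [] := ps _ (qp _ (mem_nth y iq)).
Qed.

Lemma bounded_turning_chain (C : R) (e e' : R) : compact [set: T] ->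
  bounded_turning T C -> 0 < e' -> exists m : nat,
  forall x y, mdist x y <= e -> exists c : nat -> T,
    [/\ c 0%N = x, c m.+1 = y,
        forall i, mdist (c i) (c i.+1) <= e' &
        forall i, mdist x (c i) <= C * mdist x y + e'].
Proof.
move=> cT bT e'0; have [m mP] := connected_chain cT e'0; exists m => x y xy.
have [E [_ cE Ex Ey dE]] := bT x y.
have [c [c0 cm cc cE']] := mP E cE x y Ex Ey; exists c; split=> //; first exact: cm.
move=> i; have [w Ew cw] := cE' i.
have xw : mdist x w <= C * mdist x y.
  rewrite -lee_fin (le_trans _ dE)//; apply: ereal_sup_ubound.
  by exists x => //; exists w.
by have := metric_triangle x w (c i); rewrite (metric_sym w); lra.
Qed.

(** Ensures that the link occupied at a given time in a refined chain subdivides the link occupied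
    at the same time before refinement. *)
Lemma truncn_mul_div (a : R) (N : nat) : 0 <= a -> (0 < N)%N ->
  (Num.truncn (a * N%:R) %/ N)%N = Num.truncn a.
Proof.
move=> a0 N0; have aN0 : 0 <= a * N%:R by rewrite mulr_ge0.
have N0' : 0 < N%:R :> R by rewrite ltr0n.
apply/esym/truncn_def; have /andP[h1 h2] := truncn_itv aN0.
set q := Num.truncn _ in h1 h2 *.
rewrite -(ler_pM2r N0') -(ltr_pM2r N0') -!natrM; apply/andP; split.
  by apply: le_trans h1; rewrite ler_nat leq_trunc_div.
by apply: lt_le_trans h2 _; rewrite ler_nat ltn_ceil.
Qed.

(** A chain along [E] is refined repeatedly, each link being replaced by a chain in a small
    continuum joining its ends. All links of one level receive the same number of subdivisions, so
    the chains can be run at uniform speed and converge uniformly. *)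
Lemma bounded_turning_path (C : R) E x y (r : R) : compact [set: T] ->
  1 <= C -> bounded_turning T C -> connected E -> E x -> E y -> 0 < r ->
  exists f : R -> T, [/\ {within `[0, 1], continuous f}, f 0 = x, f 1 = y &
    forall t, 0 <= t <= 1 -> exists2 w, E w & mdist (f t) w <= r].
Proof.
move=> cT C1 bT cE Ex Ey r0.
(* The first chain strays from [E] by [e 0] and all refinements together by 2 (C + 1) [e 0]; the sum
   is at most 3 (C + 1) [e 0] = r. *)
pose e (k : nat) := r / (3 * (C + 1)) / 2 ^+ k.
have D0 : 0 < 3 * (C + 1) by lra.
have e_gt0 k : 0 < e k by rewrite !divr_gt0// exprn_gt0.
have eS k : e k = 2 * e k.+1.
  by rewrite /e exprS; field; rewrite expf_neq0//=; lra.
have [m0 m0P] := connected_chain cT (e_gt0 0%N).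
have [c [c0 cm cc cE']] := m0P E cE x y Ex Ey.
have [m mP] := choice (fun k => bounded_turning_chain (e k) cT bT (e_gt0 k.+1)).
have chP k (p : T * T) : exists ch : nat -> T, mdist p.1 p.2 <= e k ->
    [/\ ch 0%N = p.1, ch (m k).+1 = p.2,
        forall i, mdist (ch i) (ch i.+1) <= e k.+1 &
        forall i, mdist p.1 (ch i) <= (C + 1) * e k].
  have [p12|/negP p12] := boolP (mdist p.1 p.2 <= e k); last by exists (fun=> x).
  have [ch [h1 h2 h3 h4]] := mP k _ _ p12; exists ch => _; split=> // i.
  have := h4 i; have := eS k; have := e_gt0 k.+1; nra.
have [ch {}chP] : exists ch : nat -> T -> T -> nat -> T, forall k u v,
    mdist u v <= e k -> [/\ ch k u v 0%N = u, ch k u v (m k).+1 = v,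
        forall i, mdist (ch k u v i) (ch k u v i.+1) <= e k.+1 &
        forall i, mdist u (ch k u v i) <= (C + 1) * e k].
  have [ch chP'] := choice (fun kp : nat * (T * T) => chP kp.1 kp.2).
  by exists (fun k u v => ch (k, (u, v))) => k u v uv; exact: (chP' (k, (u, v)) uv).
pose N k := (m k).+1.
pose g := fix g k n := if k is k'.+1 then
   ch k' (g k' (n %/ N k')%N) (g k' (n %/ N k').+1) (n %% N k')%N else c n.
pose M := fix M k := if k is k'.+1 then (M k' * N k')%N else m0.+1.
have g_step k n : mdist (g k n) (g k n.+1) <= e k.
  elim: k n => [|k IH] n /=; first exact: cc.
  set u := g k _; set v := g k _; have [h0 hN hs _] := chP k u v (IH _).
  have Nk0 : (0 < N k)%N by [].
  have [nN|nN] := ltnP (n %% N k).+1 (N k).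
    have [dE ->] : ((n.+1 %/ N k) = (n %/ N k) /\ (n.+1 %% N k) = (n %% N k).+1)%N.
      have := divn_eq n (N k); set q := (n %/ _)%N; set i := (n %% _)%N => nE.
      rewrite nE -addnS divnMDl// divn_small// addn0 modnMDl modn_small//.
    by rewrite dE; exact: hs.
  have iE : (n %% N k)%N = m k by have := ltn_pmod n Nk0; rewrite /N in nN *; lia.
  have -> : n.+1 = ((n %/ N k).+1 * N k)%N.
    by rewrite {1}(divn_eq n (N k)) iE mulSn /N; lia.
  rewrite mulnK// modnMl.
  have [-> _ _ _] := chP k _ _ (IH (n %/ N k).+1).
  by rewrite iE -/v -[X in mdist _ X]hN; exact: hs.
have g0 k : g k 0%N = x.
  elim: k => [|k IH] //=; rewrite div0n mod0n.
  by have [-> _ _ _] := chP k _ _ (g_step k 0%N).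
have gM k : g k (M k) = y.
  elim: k => [|k IH] /=; first exact: cm.
  rewrite mulnK// modnMl.
  by have [-> _ _ _] := chP k _ _ (g_step k (M k)).
have g_near k n : mdist (g k (n %/ N k)%N) (g k.+1 n) <= (C + 1) * e k.
  have [_ _ _ h] := chP k _ _ (g_step k (n %/ N k)%N).
  exact: h.
pose G k (t : R) := g k (Num.truncn (t * (M k)%:R)).
have MS k : M k.+1 = (M k * N k)%N := erefl.
have G_near k t : 0 <= t -> mdist (G k t) (G k.+1 t) <= (C + 1) * e k.
  move=> t0; rewrite /G; have := g_near k (Num.truncn (t * (M k.+1)%:R)).
  by rewrite {1}MS natrM mulrA truncn_mul_div// mulr_ge0.
have G_tail k i t : 0 <= t -> mdist (G k t) (G (k + i)%N t) <=
    2 * (C + 1) * (e k - e (k + i)%N).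
  move=> t0; elim: i => [|i IH]; first by rewrite addn0 mdistxx subrr mulr0.
  have := metric_triangle (G k t) (G (k + i)%N t) (G (k + i).+1 t).
  have := G_near (k + i)%N t t0; have := eS (k + i)%N; rewrite addnS; nra.
have [U [UU ooU]] := ultrafilter_nat.
have lim t : exists l, forall e : R, 0 < e -> U [set n | mdist (G n t) l < e].
  by have [|l _ lP] := @ultra_mdist R T setT U (fun n => G n t) UU cT _; last exists l.
have [f fP] := choice lim.
have f_near k t : 0 <= t -> mdist (G k t) (f t) <= 2 * (C + 1) * e k.
  move=> t0; apply/ler_addgt0Pr => a a0.
  have [j [/= ja kj]] := filter_ex (filterI (fP t a a0) (ooU k)).
  have := G_tail k (j - k)%N t t0; rewrite subnKC//.
  have := metric_triangle (G k t) (G j t) (f t); have := e_gt0 j; nra.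
have f_const t z : (forall k, G k t = z) -> f t = z.
  move=> Gz; apply: mdist_positivity; apply/eqP; rewrite eq_le mdist_ge0 andbT.
  apply/ler_addgt0Pr => a a0; have [j /=] := filter_ex (fP t a a0).
  by rewrite Gz metric_sym add0r => /ltW.
exists f; split.
- apply/within_continuous_mdistP => s; rewrite /= in_itv/= => /andP[s0 s1] a a0.
  have [k kP] : exists k, (1 + 4 * (C + 1)) * e k < a.
    set K := 1 + 4 * (C + 1).
    have [k Bk] : exists k : nat, K * (r / (3 * (C + 1))) / a < k%:R.
      exists (Num.truncn (K * (r / (3 * (C + 1))) / a)).+1.
      exact: truncnS_gt.
    exists k; rewrite /e mulrA ltr_pdivrMr ?exprn_gt0// [ltRHS]mulrC -ltr_pdivrMr//.
    by rewrite (lt_le_trans Bk)// -natrX ler_nat; exact/ltnW/ltn_expl.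
  have Mk0 : 0 < (M k)%:R :> R by rewrite ltr0n; elim: (k) => //= j; rewrite muln_gt0 => ->.
  exists (M k)%:R^-1; first by rewrite invr_gt0.
  move=> t; rewrite /= in_itv/= => /andP[t0 t1] st.
  have near_st : mdist (G k s) (G k t) <= e k.
    wlog : s t s0 s1 t0 t1 st / s <= t => [H|le_st].
      case: (leP s t) => [|/ltW] h; first exact: H.
      by rewrite metric_sym; apply: H => //; rewrite distrC.
    rewrite /G; set p := Num.truncn _; set q := Num.truncn _.
    have pq : (p <= q)%N by apply: le_truncn; rewrite ler_wpM2r// ltW.
    have tM0 : 0 <= t * (M k)%:R by rewrite mulr_ge0// ltW.
    have sM0 : 0 <= s * (M k)%:R by rewrite mulr_ge0// ltW.
    have /andP[p1 p2] := truncn_itv sM0; have /andP[q1 q2] := truncn_itv tM0.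
    have : q%:R < p.+2%:R :> R.
      rewrite distrC ger0_norm ?subr_ge0// in st.
      move: st; rewrite -(ltr_pM2r Mk0) mulVf ?gt_eqF// mulrBl.
      rewrite -/p in p1 p2; rewrite -/q in q1 q2.
      rewrite -[p.+2]addn2 natrD; rewrite -[p.+1]addn1 natrD in p2; lra.
    rewrite ltr_nat ltnS leq_eqVlt => /predU1P[->|qp]; first exact: g_step.
    have -> : q = p by apply/eqP; rewrite eqn_leq pq andbT.
    by rewrite mdistxx ltW.
  have h1 := f_near k s s0; have h2 := f_near k t t0.
  have := metric_triangle (f s) (G k s) (f t).
  have := metric_triangle (G k s) (G k t) (f t).
  rewrite (metric_sym (f s) (G k s)); lra.
- by apply: f_const => k; rewrite /G mul0r truncn0.
- by apply: f_const => k; rewrite /G mul1r natrK.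
- move=> t /andP[t0 t1]; have [w Ew cw] := cE' (Num.truncn (t * (M 0%N)%:R)).
  exists w => //; have := f_near 0%N t t0; rewrite /G /=.
  have := metric_triangle (f t) (G 0%N t) w; rewrite (metric_sym (f t) (G 0%N t)) /G /=.
  have e0E : e 0%N * (3 * (C + 1)) = r.
    by rewrite /e expr0 divr1 divfK// gt_eqF.
  have := e_gt0 0%N; move: cw; rewrite /=; nra.
Qed.

End Chains.

(** * From paths to arcs *)

Lemma closed_last (R : realType) (K : set R) (s t : R) : closed K -> K s -> s <= t ->
  exists a, [/\ K a, s <= a, a <= t & forall u, a < u -> u <= t -> ~ K u].
Proof.
move=> cK Ks st; pose A := K `&` [set u | u <= t].
have As : A s by [].
have hA : has_ubound A by exists t => u [].
have Asup : A (sup A).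
  have : closure A (sup A) by apply: closure_sup => //; exists s.
  by apply: (closedI cK (@closed_le R t)).
exists (sup A); have [Ka at_] := Asup; split=> //.
  exact: ub_le_sup.
move=> u au ut Ku; have : u <= sup A by apply: ub_le_sup.
by rewrite leNgt au.
Qed.

Lemma closed_first (R : realType) (K : set R) (s t : R) : closed K -> K t -> s <= t ->
  exists a, [/\ K a, s <= a, a <= t & forall u, s <= u -> u < a -> ~ K u].
Proof.
move=> cK Kt st.
have cK' : closed [set u | K (- u)].
  by apply: (closed_comp _ cK) => u _; exact: opp_continuous.
have [||a [Ka ta as_ aP]] := @closed_last R _ (- t) (- s) cK'.
- by rewrite /= opprK.
- by rewrite lerN2.
exists (- a); split=> //; [lra|lra|] => u su ua Ku.
by apply: (aP (- u)); rewrite ?opprK//=; [lra|lra|rewrite opprK].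
Qed.

Lemma total_on_max (X : Type) (F : set (set X)) : total_on F subset ->
  forall s : seq (set X), (forall U, U \in s -> F U) -> s <> [::] ->
  exists2 U, F U & forall V, V \in s -> V `<=` U.
Proof.
move=> totF; elim=> // V s IH sF _; have FV : F V by apply: sF; rewrite inE eqxx.
have [->|s0] := pselect (s = [::]).
  by exists V => // W; rewrite inE => /eqP ->.
have [|//|U FU sU] := IH; first by move=> W Ws; apply: sF; rewrite inE Ws orbT.
have [VU|UV] := totF V U FV FU.
  by exists U => // W; rewrite inE => /predU1P[->|/sU].
by exists V => // W; rewrite inE => /predU1P[->//|/sU WU]; exact: subset_trans WU UV.
Qed.

Lemma chain_cover_itv (R : realType) (F : set (set R)) (s t : R) : s <= t ->
  total_on F subset -> (forall U, F U -> open U) ->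
  `[s, t] `<=` \bigcup_(U in F) U -> exists2 U, F U & `[s, t] `<=` U.
Proof.
move=> st totF oF cov; have := @segment_compact R s t; rewrite compact_cover.
move=> /(_ (set R) F id oF cov)[D DF Dcov].
have sD : forall U, U \in enum_fset D -> F U by move=> U UD; apply/set_mem/DF.
have [D0|U FU UD] := total_on_max totF sD.
  have [|V /= VD _] := Dcov s; first by rewrite /= in_itv/= lexx.
  by move: VD; rewrite -[V \in D]/(V \in enum_fset D) D0.
by exists U => // u /Dcov[V /= VD Vu]; exact: (UD V).
Qed.

Section LoopErasure.
Context {R : realType} {T : metricType R}.

(** The complement of [K] is a maximal open set such that [f] agrees at the two ends of each of its
    gaps, that is, a maximal family of loops to cut out. Maximality leaves no further loop between
    points of [K]. *)
Lemma loop_erasure (f : R -> T) : {within `[0, 1], continuous f} ->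
  exists K : set R, [/\ closed K, K 0, K 1,
    forall s t : R, 0 <= s -> s < t -> t <= 1 -> K s -> K t ->
      (forall u : R, s < u -> u < t -> ~ K u) -> f s = f t &
    forall s t : R, 0 <= s -> s < t -> t <= 1 -> K s -> K t -> f s = f t ->
      forall u : R, s < u -> u < t -> ~ K u].
Proof.
move=> cf; have uf := within_continuous_unif (@segment_compact _ _ _) cf.
pose gap (U : set R) := forall s t : R, 0 <= s -> s < t -> t <= 1 -> ~ U s -> ~ U t ->
  (forall u : R, s < u -> u < t -> U u) -> f s = f t.
pose P : set (set R) := [set U : set R | [/\ open U, ~ U 0, ~ U 1 & gap U]].
have [|U [[oU U0 U1 gU] maxU]] := @Zorn_bigcup R P.
  move=> F FP totF; split.
  - by apply: bigcup_open => U /FP[].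
  - by move=> [U /FP[]].
  - by move=> [U /FP[]].
  move=> s t s0 st t1 nUs nUt stU.
  apply: mdist_positivity; apply/eqP; rewrite eq_le mdist_ge0 andbT.
  apply/ler_addgt0Pr => e e0; rewrite add0r.
  have [|del del0 fdel] := uf (e / 2); first by rewrite divr_gt0.
  pose h := Num.min del (t - s) / 3.
  have m0 : 0 < Num.min del (t - s) by rewrite lt_min del0 subr_gt0.
  have m1 : Num.min del (t - s) <= del by rewrite ge_min lexx.
  have m2 : Num.min del (t - s) <= t - s by rewrite ge_min lexx orbT.
  (* The shrunken gap is compact, hence inside one member of the chain. The gap of that member
     around it ends within h of s and of t, and [f] agrees at its ends. *)
  have [U FU stU'] : exists2 U, F U & `[s + h, t - h] `<=` U.
    apply: chain_cover_itv => //; first by rewrite /h; lra.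
      by move=> U /FP[].
    by move=> u; rewrite /= in_itv/= => /andP[su ut]; apply: stU; move: su ut; rewrite /h; lra.
  have [oU U0 U1 gU] := FP _ FU.
  have nUs' : ~ U s by move=> Us; apply: nUs; exists U.
  have nUt' : ~ U t by move=> Ut; apply: nUt; exists U.
  have cU := open_closedC oU.
  have [||a [Ka sa ah aP]] := @closed_last R (~` U) s (s + h) cU => //.
    by rewrite /h; lra.
  have [||b [Kb hb bt bP]] := @closed_first R (~` U) (t - h) t cU => //.
    by rewrite /h; lra.
  have fab : f a = f b.
    apply: gU => //; [lra|by move: ah hb; rewrite /h; lra|lra|] => u au ub.
    have [uh|hu] := leP u (s + h).
      by apply: contrapT; exact: aP.
    have [hu'|hu'] := ltP u (t - h); last by apply: contrapT; exact: bP.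
    by apply: stU'; rewrite /= in_itv/=; lra.
  have d1 : mdist (f s) (f a) < e / 2.
    apply: fdel; rewrite /= ?in_itv/=; [lra|by move: ah; rewrite /h; lra|].
    by rewrite distrC ger0_norm ?subr_ge0//; move: ah; rewrite /h; lra.
  have d2 : mdist (f b) (f t) < e / 2.
    apply: fdel; rewrite /= ?in_itv/=; [by move: hb; rewrite /h; lra|lra|].
    by rewrite distrC ger0_norm ?subr_ge0//; move: hb; rewrite /h; lra.
  have := metric_triangle (f s) (f a) (f t); rewrite fab in d1 *; lra.
exists (~` U); split=> //; first exact: open_closedC.
  move=> s t s0 st t1 Ks Kt nK; apply: gU => // u su ut.
  by apply: contrapT; exact: nK.
move=> s t s0 st t1 Ks Kt fst u su ut /=; apply.
apply: contrapT => nUu; apply: (maxU (U `|` `]s, t[)).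
  split; first by move=> v; left.
  by move=> h; apply: nUu; apply: h; right; rewrite /= in_itv/= su.
split.
- by apply: openU => //; exact: itv_open.
- by case=> //; rewrite /= in_itv/= => /andP[]; lra.
- by case=> //; rewrite /= in_itv/= => /andP[]; lra.
(* As s and t stay outside the enlarged set, a gap of it is either contained in [U] or equal to ]s,
   t[. *)
move=> a b a0 ab b1 nVa nVb abV.
have nUa : ~ U a by move=> Ua; apply: nVa; left.
have nUb : ~ U b by move=> Ub; apply: nVb; left.
have [abU|] := pselect (forall c : R, a < c -> c < b -> U c); first exact: gU.
move=> /existsNP[c /not_implyP[ac /not_implyP[cb nUc]]].
have [//|] := abV c ac cb; rewrite /= in_itv/= => /andP[sc ct].
have stE v : ~ (U `|` `]s, t[) v -> ~ (s < v < t).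
  by move=> nv h; apply: nv; right; rewrite /= in_itv.
have sV : ~ (a < s < b).
  move=> /andP[as_ sb]; have [//|] := abV s as_ sb; rewrite /= in_itv/= ltxx.
  by [].
have tV : ~ (a < t < b).
  move=> /andP[at_ tb]; have [//|] := abV t at_ tb; rewrite /= in_itv/= ltxx andbF.
  by [].
have := stE _ nVa; have := stE _ nVb => nb na.
have aE : a = s by move: na sV; lra.
have bE : b = t by move: nb tV; lra.
by rewrite aE bE.
Qed.

End LoopErasure.

Section Arcs.
Context {R : realType} {T : metricType R}.

(** [f] is frozen on each gap of [K], at its value at the last earlier point of [K]. Two points of
    [K] with equal values have no point of [K] between them, so every fibre becomes an interval. *)
Lemma monotone_path (f : R -> T) : {within `[0, 1], continuous f} ->
  exists h : R -> T, [/\ {within `[0, 1], continuous h}, h 0 = f 0, h 1 = f 1,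
    h @` `[0, 1] `<=` f @` `[0, 1] &
    forall s u t : R, 0 <= s -> s <= u -> u <= t -> t <= 1 -> h s = h t -> h u = h s].
Proof.
move=> cf; have uf := within_continuous_unif (@segment_compact _ _ _) cf.
have [K [cK K0 K1 gapK injK]] := loop_erasure cf.
have last_ex (t : R) : exists a : R, 0 <= t ->
    [/\ K a, 0 <= a, a <= t & forall u, a < u -> u <= t -> ~ K u].
  have [t0|t0] := leP 0 t; last by exists 0; lra.
  by have [a] := closed_last cK K0 t0; exists a.
have [l lP] := choice last_ex.
have l_le s t : 0 <= s -> s <= t -> l s <= l t.
  move=> s0 st; have [Ks ls0 lss _] := lP s s0.
  have [_ _ _ lt] := lP t (le_trans s0 st).
  by rewrite leNgt; apply/negP => h; exact: (lt _ h (le_trans lss st)).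
have l_fix t : 0 <= t -> K t -> l t = t.
  move=> t0 Kt; have [_ _ ltt lt] := lP t t0; apply/eqP; rewrite eq_le ltt/= leNgt.
  by apply/negP => h; exact: (lt _ h (lexx t)).
have fE s t : 0 <= s -> s <= t -> t <= 1 -> K s -> K t ->
    (forall u, s < u -> u < t -> ~ K u) -> f s = f t.
  move=> s0; rewrite le_eqVlt => /predU1P[-> //|st] t1 Ks Kt; exact: gapK.
exists (f \o l); split=> /=.
- apply/within_continuous_mdistP => s; rewrite /= in_itv/= => /andP[s0 s1] e e0.
  have [del del0 fdel] := uf e e0; exists del => //.
  move=> t; rewrite /= in_itv/= => /andP[t0 t1] st.
  wlog le_st : s t s0 s1 t0 t1 st / s <= t => [H|].
    have [|/ltW] := leP s t; first exact: H.
    by rewrite metric_sym; apply: H => //; rewrite distrC.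
  have [Ks ls0 lss ls] := lP s s0; have [Kt lt0 ltt lt] := lP t t0.
  have [ts|st'] := ltP (l t) s.
    have -> : l t = l s.
      apply/eqP; rewrite eq_le (l_le s t)// andbT leNgt; apply/negP => h.
      exact: (ls _ h (ltW ts)).
    by rewrite mdistxx.
  have [b [Kb sb blt bP]] := closed_first cK Kt st'.
  have -> : f (l s) = f b.
    apply: fE => //; [lra|lra|] => u lu ub; have [us|su] := leP u s; first exact: ls.
    by apply: bP => //; exact: ltW.
  apply: fdel; rewrite /= ?in_itv/=; [lra|lra|].
  by rewrite distrC ger0_norm ?subr_ge0//; rewrite distrC ger0_norm ?subr_ge0// in st; lra.
- by rewrite l_fix.
- by rewrite l_fix.
- move=> _ [t + <-]; rewrite /= in_itv/= => /andP[t0 t1]; exists (l t) => //=.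
  by have [_ lt0 ltt _] := lP t t0; rewrite in_itv/=; lra.
- move=> s u t s0 su ut t1 fst.
  have u0 : 0 <= u by lra.
  have t0 : 0 <= t by lra.
  have [Ks ls0 lss ls] := lP s s0; have [Kt lt0 ltt lt] := lP t t0.
  have [Ku lu0 luu lu] := lP u u0.
  have := l_le s u s0 su; rewrite le_eqVlt => /predU1P[-> //|lsu].
  have := l_le u t u0 ut; rewrite le_eqVlt => /predU1P[-> //|lut].
  by exfalso; apply: (injK (l s) (l t) _ _ _ Ks Kt fst (l u) lsu lut) => //; lra.
Qed.

(* [r] accumulates, over the rational base points [q], the running maxima of the
   distance to [h q]: it increases exactly when [h] moves. *)
Lemma monotone_clock (h : R -> T) : {within `[0, 1], continuous h} ->
  (forall s u t : R, 0 <= s -> s <= u -> u <= t -> t <= 1 -> h s = h t -> h u = h s) ->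
  exists r : R -> R, [/\ {within `[0, 1], continuous r},
    forall s t, 0 <= s -> s <= t -> t <= 1 -> r s <= r t &
    forall s t, 0 <= s -> s <= t -> t <= 1 -> r s = r t <-> h s = h t].
Proof.
move=> ch fibre; have uh := within_continuous_unif (@segment_compact _ _ _) ch.
pose dm x y : R := Num.min 1 (mdist (h x) (h y)).
(* The value 0 makes the running maximum vanish before time q, and the cap at 1 in [dm] makes the
   weighted sum over the rationals converge. *)
pose A q t : set R := [set x | x = 0 \/ exists u, [/\ 0 <= q, q <= u, u <= t & x = dm q u]].
pose D q t := sup (A q t).
have dm01 x y : 0 <= dm x y <= 1 by rewrite le_min ler01 mdist_ge0 ge_min lexx.
have A_ub q t : ubound (A q t) 1.
  by move=> x [->//|[u [_ _ _ ->]]]; case/andP: (dm01 q u).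
have A_sup q t : has_sup (A q t) by split; [exists 0; left|exists 1; exact: A_ub].
have D_ge q t x : A q t x -> x <= D q t.
  by move=> Ax; apply: ub_le_sup => //; exists 1; exact: A_ub.
have D_le q t y : 0 <= y -> (forall u, 0 <= q -> q <= u -> u <= t -> dm q u <= y) ->
    D q t <= y.
  move=> y0 H; apply: ge_sup; first by exists 0; left.
  by move=> x [->//|[u [q0 qu ut ->]]]; exact: H.
have D0 q t : 0 <= D q t by apply: D_ge; left.
have D1 q t : D q t <= 1 by apply: D_le => // u _ _ _; case/andP: (dm01 q u).
have D_mono q s t : s <= t -> D q s <= D q t.
  move=> st; apply: D_le => // u q0 qu us; apply: D_ge; right; exists u; split=> //; lra.
have D_unif e : 0 < e -> exists2 del : R, 0 < del & forall q s t, 0 <= s -> s <= t -> t <= 1 ->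
    t - s < del -> D q t <= D q s + e.
  move=> e0; have [del del0 hdel] := uh e e0; exists del => // q s t s0 st t1 ts.
  apply: D_le => [|u q0 qu ut]; first by rewrite addr_ge0// ltW.
  have [us|su] := leP u s.
    have : dm q u <= D q s by apply: D_ge; right; exists u.
    lra.
  have [qs|sq] := leP q s; last first.
    have : mdist (h q) (h u) < e.
      apply: hdel; rewrite /= ?in_itv/=; [lra|lra|].
      by rewrite distrC ger0_norm ?subr_ge0//; lra.
    have : dm q u <= mdist (h q) (h u) by rewrite ge_min lexx orbT.
    by have := D0 q s; lra.
  have h1 : dm q s <= D q s by apply: D_ge; right; exists s.
  have h2 : mdist (h s) (h u) < e.
    apply: hdel; rewrite /= ?in_itv/=; [lra|lra|].
    by rewrite distrC ger0_norm ?subr_ge0 ?ltW//; lra.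
  have := metric_triangle (h q) (h s) (h u) => h3.
  move: h1; rewrite /dm ge_min => /orP[h1|h1].
    rewrite (le_trans (_ : _ <= 1))//; [by rewrite ge_min lexx|lra].
  rewrite (le_trans (_ : _ <= mdist (h q) (h u)))//; [by rewrite ge_min lexx orbT|lra].
have D_const q s t : 0 <= s -> s <= t -> t <= 1 -> h s = h t -> D q s = D q t.
  move=> s0 st t1 hst; apply/eqP; rewrite eq_le D_mono//=.
  apply: D_le => // u q0 qu ut.
  have [us|su] := leP u s; first by apply: D_ge; right; exists u.
  have hu : h u = h s by apply: (fibre s u t) => //; exact: ltW.
  have [qs|sq] := leP q s.
    by apply: D_ge; right; exists s; split=> //; rewrite /dm hu.
  have hq : h q = h s by apply: (fibre s q t) => //; [exact: ltW|exact: le_trans ut].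
  by rewrite /dm hu hq mdistxx min_r.
have [qs qsP] : exists qs : nat -> R, forall s t : R, s < t -> exists i, s < qs i < t.
  exists (fun i : nat => if @choice.unpickle rat i is Some q then ratr q else 0).
  move=> s t /rat_in_itvoo[q].
  by rewrite in_itv/= => qst; exists (@choice.pickle rat q); rewrite choice.pickleK.
pose S n t : R := \sum_(i < n) D (qs i) t / 2 ^+ i.+1.
have S_step n t i : S n t <= S (n + i)%N t <= S n t + 1 / 2 ^+ n - 1 / 2 ^+ (n + i).
  elim: i => [|i /andP[IH1 IH2]]; first by rewrite addn0 lexx/=; lra.
  rewrite addnS {2 3}/S big_ord_recr/= -/(S _ _).
  have p0 : 0 < 2 ^+ (n + i) :> R by rewrite exprn_gt0.
  have := D0 (qs (n + i)%N) t; have := D1 (qs (n + i)%N) t.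
  set d := D _ _ => d1 d0; rewrite exprS invfM.
  have i0 : 0 < (2 ^+ (n + i))^-1 :> R by rewrite invr_gt0.
  by apply/andP; split; nra.
pose rs t : set R := [set S n t | n in setT].
pose r t := sup (rs t).
have p2 n : 0 < 1 / 2 ^+ n :> R by rewrite divr_gt0// exprn_gt0.
have S_le n m t : S m t <= S n t + 1 / 2 ^+ n.
  have [nm|/ltnW mn] := leqP n m.
    have /andP[_] := S_step n t (m - n)%N; rewrite subnKC//.
    by have := p2 m; lra.
  have /andP[+ _] := S_step m t (n - m)%N; rewrite subnKC//.
  by have := p2 n; lra.
have r_ge n t : S n t <= r t.
  apply: ub_le_sup; last by exists n.
  by exists (S 0%N t + 1 / 2 ^+ 0) => _ [m _ <-]; exact: S_le.
have r_le n t : r t <= S n t + 1 / 2 ^+ n.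
  by apply: ge_sup; [exists (S 0%N t), 0%N|move=> _ [m _ <-]; exact: S_le].
have S_mono n s t : s <= t -> S n s <= S n t.
  by move=> st; apply: ler_sum => i _; rewrite ler_pM2r ?invr_gt0 ?exprn_gt0//; exact: D_mono.
have half_small e : 0 < e -> exists N, 1 / 2 ^+ N < e :> R.
  move=> e0; exists (Num.truncn (1 / e)).+1.
  rewrite ltr_pdivrMr ?exprn_gt0// mulrC -ltr_pdivrMr//.
  apply: lt_trans (_ : (Num.truncn (1 / e)).+1%:R < _); first exact: truncnS_gt.
  by rewrite -natrX ltr_nat ltn_expl.
have r_mono s t : s <= t -> r s <= r t.
  move=> st; apply/ler_addgt0Pr => e /half_small[n ne].
  have := r_le n s; have := r_ge n t; have := S_mono n s t st; lra.
exists r; split=> [|s t _ + _|s t s0 st t1]; [|exact: r_mono|].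
- apply/within_continuous_ballP => s; rewrite /= in_itv/= => /andP[s0 s1] e e0.
  have [|n ne] := half_small (e / 2); first by rewrite divr_gt0.
  have [|del del0 Ddel] := D_unif (e / 2); first by rewrite divr_gt0.
  exists del => // t; rewrite /= in_itv/= => /andP[t0 t1] st; rewrite -ball_normE/=.
  wlog le_st : s t s0 s1 t0 t1 st / s <= t => [H|].
    have [|/ltW] := leP s t; first exact: H.
    by rewrite distrC; apply: H => //; rewrite distrC.
  rewrite distrC ger0_norm ?subr_ge0 ?r_mono//.
  rewrite distrC ger0_norm ?subr_ge0// in st.
  have Sn : S n t <= S n s + e / 2.
    have : S n t <= \sum_(i < n) (D (qs i) s / 2 ^+ i.+1 + e / 2 / 2 ^+ i.+1).
      apply: ler_sum => i _; rewrite -mulrDl ler_pM2r ?invr_gt0 ?exprn_gt0//.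
      exact: Ddel.
    rewrite big_split/= -mulr_sumr => /le_trans; apply; rewrite lerD2l.
    rewrite ler_piMr ?divr_ge0 ?ltW//.
    suff -> : \sum_(i < n) (2 ^+ i.+1)^-1 = 1 - 1 / 2 ^+ n :> R by have := p2 n; lra.
    elim: (n) => [|m IH]; first by rewrite big_ord0 expr0 divr1 subrr.
    by rewrite big_ord_recr/= IH exprS; field; rewrite expf_neq0.
  have := r_le n t; have := r_ge n s; lra.
- split=> [rst|hst]; last first.
    have SE n : S n s = S n t.
      by apply: eq_bigr => i _; rewrite (D_const _ s t).
    by rewrite /r /rs; congr sup; apply/seteqP; split=> _ [n _ <-]; exists n.
  apply: contrapT => nh.
  have {}st : s < t.
    by rewrite lt_neqAle st andbT; apply/eqP => E; apply: nh; rewrite E.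
  (* Otherwise [h] takes the value [h t] arbitrarily close to s, and [h s = h t] by continuity. The
     maximum based at such a rational is 0 at s and positive at t. *)
  have [i [/andP[sq qt] qh]] : exists i, s < qs i < t /\ h (qs i) <> h t.
    apply: contrapT => nq; apply: nh; apply: mdist_positivity.
    apply/eqP; rewrite eq_le mdist_ge0 andbT; apply/ler_addgt0Pr => e e0; rewrite add0r.
    have [del del0 hdel] := uh e e0.
    have [|i /andP[sq qt]] := qsP s (Num.min t (s + del)); first by rewrite lt_min; lra.
    move: qt; rewrite lt_min => /andP[qt qd].
    have <- : h (qs i) = h t.
      by apply: contrapT => nE; apply: nq; exists i; split=> //; rewrite sq.
    apply/ltW/hdel; rewrite /= ?in_itv/=; [lra|lra|].
    by rewrite distrC ger0_norm ?subr_ge0 ?ltW//; lra.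
  have Ds : D (qs i) s = 0.
    apply/eqP; rewrite eq_le D0 andbT; apply: D_le => // u _ qu us.
    by have := le_trans qu us; rewrite leNgt sq.
  have Dt : 0 < D (qs i) t.
    apply: (@lt_le_trans _ _ (dm (qs i) t)).
      by rewrite lt_min ltr01 mdist_gt0; apply/eqP.
    by apply: D_ge; right; exists t; split=> //; lra.
  set c := D (qs i) t / 2 ^+ i.+1; have c0 : 0 < c by rewrite divr_gt0// exprn_gt0.
  have [n nc] := half_small c c0.
  have : S (i.+1 + n)%N s + c <= S (i.+1 + n)%N t.
    have iN : (i < i.+1 + n)%N by rewrite addSn ltnS leq_addr.
    rewrite /S (bigD1 (Ordinal iN))//= [leRHS](bigD1 (Ordinal iN))//= Ds mul0r add0r addrC.
    apply: lerD => //; apply: ler_sum => j _.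
    by rewrite ler_pM2r ?invr_gt0 ?exprn_gt0//; apply: D_mono; exact: ltW.
  have n2 : 1 / 2 ^+ (i.+1 + n) <= 1 / 2 ^+ n :> R.
    by rewrite !div1r lef_pV2 ?posrE ?exprn_gt0// ler_eXn2l ?leq_addl//; lra.
  have := r_ge (i.+1 + n)%N t; have := r_le (i.+1 + n)%N s; rewrite rst; lra.
Qed.

End Arcs.

(** A continuous map from a compact space to a Hausdorff one is closed, so continuity descends
    through [phi]. *)
Lemma factor_continuous (X Y Z : topologicalType) (K : set X)
    (phi : X -> Y) (h : X -> Z) (F : Y -> Z) :
  compact K -> hausdorff_space Y ->
  {within K, continuous phi} -> {within K, continuous h} ->
  (forall x, K x -> F (phi x) = h x) -> {within phi @` K, continuous F}.
Proof.
move=> cK hY cphi ch FE; apply/continuous_closedP => W cW; apply/closed_subspaceP.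
have /closed_subspaceP[V cV VE] := (continuous_closedP _).1 ch W cW.
have KV x : K x -> V x <-> W (h x).
  move=> Kx; have <- : (V `&` K) x = V x.
    by apply/propext; split=> [[]|].
  by rewrite VE; split=> [[]|].
exists (phi @` (K `&` V)).
  apply: compact_closed => //; apply: continuous_compact; last exact: compact_closedI.
  by apply: continuous_subspaceW cphi => x [].
apply/seteqP; split=> [y [[x [Kx Vx] <-] _]|y /= [Wy [x Kx yE]]].
  by split; [change (W (F (phi x))); rewrite FE//; exact/KV|exists x].
rewrite -yE; split; exists x => //; split=> //; apply/KV => //.
by rewrite -FE// yE.
Qed.

Section HullArc.
Context {R : realType} {T : metricType R}.
Implicit Types (x y z w : T) (E A : set T).

(** The monotone path [h] and its normalized clock [phi] have the same fibres, so each factors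
    through the other; the two factors are the inverse homeomorphisms. *)
Lemma path_arc (f : R -> T) : {within `[0, 1], continuous f} -> f 0 <> f 1 ->
  exists2 A, jordan_arc (f 0) (f 1) A & A `<=` f @` `[0, 1].
Proof.
move=> cf f01; have [h [ch h0 h1 hf fib]] := monotone_path cf.
have [r [cr r_mono rP]] := monotone_clock ch fib.
have I0 : `[0, 1]%classic (0 : R) by rewrite /= in_itv/= lexx ler01.
have I1 : `[0, 1]%classic (1 : R) by rewrite /= in_itv/= lexx ler01.
have r01 : r 0 < r 1.
  rewrite lt_neqAle r_mono// andbT; apply/eqP => /rP; rewrite h0 h1.
  by move=> E; apply: f01; apply: E.
pose c := r 1 - r 0; have c0 : 0 < c by rewrite subr_gt0.
pose phi t := (r t - r 0) / c.
have cphi : {within `[0, 1], continuous phi}.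
  apply/within_continuous_ballP => s Is e e0.
  have [|del del0 rd] := (within_continuous_ballP _ _).1 cr s Is (e * c); first exact: mulr_gt0.
  exists del => // t It st; have := rd t It st; rewrite -!ball_normE/= /phi.
  rewrite -mulrBl opprB addrA subrK normrM normfV (gtr0_norm c0).
  by rewrite ltr_pdivrMr.
have phi0 : phi 0 = 0 by rewrite /phi subrr mul0r.
have phi1 : phi 1 = 1 by rewrite /phi divff// gt_eqF.
have phi_inj s t : 0 <= s <= 1 -> 0 <= t <= 1 -> phi s = phi t <-> h s = h t.
  have phir : phi s = phi t <-> r s = r t.
    split=> [|rst]; last by rewrite /phi rst.
    rewrite /phi => /(mulIf _) E; apply: (addIr (- r 0)); apply: E.
    by rewrite invr_neq0// gt_eqF.
  move=> /andP[s0 s1] /andP[t0 t1]; rewrite phir.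
  have [st|/ltW ts] := leP s t; first exact: rP.
  by split=> E; apply/esym; apply/rP.
have phi01 t : 0 <= t <= 1 -> 0 <= phi t <= 1.
  move=> /andP[t0 t1]; have := r_mono 0 t; have := r_mono t 1.
  rewrite !lexx t0 t1 => /(_ isT isT isT) a /(_ isT isT isT) b.
  apply/andP; split; first by apply: divr_ge0; [rewrite subr_ge0|exact: ltW].
  by rewrite ler_pdivrMr// mul1r /c lerD2r.
have phi_img : phi @` `[0, 1] = `[0, 1]%classic.
  apply/seteqP; split=> [_ [t + <-]|v]; rewrite /= !in_itv/=; first exact: phi01.
  move=> v01; have [|t + <-] := @IVT _ phi 0 1 v ler01 cphi.
    by rewrite phi0 phi1 minEle maxEle ler01.
  by move=> t01; exists t.
have inv_phi (v : R) : exists t : R, 0 <= v <= 1 -> 0 <= t <= 1 /\ phi t = v.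
  have [v01|/negP nv] := boolP (0 <= v <= 1); last by exists 0.
  have [t] : (phi @` `[0, 1]) v by rewrite phi_img /= in_itv.
  by rewrite /= in_itv/= => t01 tv; exists t.
have [ip ipP] := choice inv_phi.
have inv_h w : exists t : R, (h @` `[0, 1]) w -> 0 <= t <= 1 /\ h t = w.
  have [[t + <-]|nw] := pselect ((h @` `[0, 1]) w); last by exists 0.
  by rewrite /= in_itv/= => t01; exists t.
have [ih ihP] := choice inv_h.
pose F := h \o ip; pose G := phi \o ih.
have Fphi t : 0 <= t <= 1 -> F (phi t) = h t.
  by move=> t01; have [i01 iE] := ipP (phi t) (phi01 t t01); apply/phi_inj.
have Gh t : 0 <= t <= 1 -> G (h t) = phi t.
  move=> t01; have [|i01 iE] := ihP (h t); first by exists t => //=; rewrite in_itv.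
  exact/phi_inj.
exists (h @` `[0, 1]) => //; exists F, G; split.
- rewrite -phi_img; apply: (factor_continuous _ _ cphi ch).
  + exact: segment_compact.
  + exact: norm_hausdorff.
  + by move=> t; rewrite /= in_itv/=; exact: Fphi.
- apply: (factor_continuous _ _ ch cphi).
  + exact: segment_compact.
  + exact: metric_hausdorff.
  + by move=> t; rewrite /= in_itv/=; exact: Gh.
- apply/seteqP; split=> _ [t + <-]; rewrite /= in_itv/= => t01.
    by have [i01 _] := ipP t t01; exists (ip t) => //=; rewrite in_itv.
  by exists (phi t); [rewrite /= in_itv/=; exact: phi01|exact: Fphi].
- move=> v; rewrite in_itv/= => v01; have [i01 iE] := ipP v v01.
  by rewrite [F v]/= Gh.
- by have F0 := Fphi 0; have F1 := Fphi 1; rewrite -h0 -h1 -F0 -?F1 ?lexx ?ler01// phi0 phi1.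
Qed.

(* In a uniquely arcwise connected space of bounded turning, every connected set
   containing the end points contains the arc: otherwise a path close to the set, from
   chains of small continua, would contain a second arc. *)
Lemma arc_sub_connected (C : R) E A x y : compact [set: T] ->
  1 <= C -> bounded_turning T C ->
  (forall x y : T, x <> y -> exists! A : set T, jordan_arc x y A) ->
  closed E -> connected E -> E x -> E y -> x <> y -> jordan_arc x y A -> A `<=` E.
Proof.
move=> cT C1 bT uT clE cE Ex Ey xy Axy z Az.
apply: clE => V /nbhs_mdistP[e e0 zV].
have e20 : 0 < e / 2 by rewrite divr_gt0.
have [f [cf f0 f1 fE]] := bounded_turning_path cT C1 bT cE Ex Ey e20.
have [|A' A'xy A'f] := path_arc cf; first by rewrite f0 f1.
have AA' : A = A'.
  have [B [_ uB]] := uT x y xy; rewrite -(uB _ Axy); apply: uB.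
  by rewrite -f0 -f1.
have [t + tz] : (f @` `[0, 1]) z by apply: A'f; rewrite -AA'.
rewrite /= in_itv/= => /fE[w Ew]; rewrite tz => zw.
by exists w; split=> //; apply: zV; lra.
Qed.

End HullArc.

(** * Hulls in trees *)

Section Hull.
Context {R : realType} {T : metricType R}.
Implicit Types (x y z w p a b : T) (E A : set T).

(** In the trees considered this is the arc from [x] to [y]. As an intersection of continua it
    includes the case x = y, and symmetry and the triangle inclusion hold without any
    parametrization. *)
Definition hull x y : set T :=
  [set w | forall E, compact E -> connected E -> E x -> E y -> E w].

Lemma hull_left x y : hull x y x. Proof. by move=> E. Qed.

Lemma hull_right x y : hull x y y. Proof. by move=> E. Qed.

Lemma hullC x y : hull x y = hull y x.
Proof. by apply/seteqP; split=> w h E cE conE Ex Ey; exact: h. Qed.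

Lemma hull_refl x w : hull x x w -> w = x.
Proof. by move=> /(_ [set x]); apply => //; [exact: compact_set1|exact: connected1]. Qed.

Lemma hull_triangle x y z : hull x z `<=` hull x y `|` hull y z.
Proof.
move=> w xzw; apply: contrapT => /not_orP[].
move=> /existsNP[E /not_implyP[cE /not_implyP[kE /not_implyP[Ex /not_implyP[Ey nE]]]]].
move=> /existsNP[F /not_implyP[cF /not_implyP[kF /not_implyP[Fy /not_implyP[Fz nF]]]]].
have [//|//] : (E `|` F) w; apply: xzw; [exact: compactU| |by left|by right].
by apply: connectedU => //; exists y.
Qed.

Lemma hull_subl x y w : hull x y w -> hull x w `<=` hull x y.
Proof. by move=> xyw v xwv E cE kE Ex Ey; apply: xwv => //; exact: xyw. Qed.

Lemma hull_subr x y w : hull x y w -> hull w y `<=` hull x y.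
Proof. by move=> xyw v xwv E cE kE Ex Ey; apply: xwv => //; exact: xyw. Qed.

Lemma hull_mdist (C : R) x y u v : bounded_turning T C ->
  hull x y u -> hull x y v -> mdist u v <= C * mdist x y.
Proof.
move=> bT xyu xyv; have [E [cE kE Ex Ey dE]] := bT x y.
rewrite -lee_fin (le_trans _ dE)//; apply: ereal_sup_ubound.
by exists u; [exact: xyu|exists v => //; exact: xyv].
Qed.

Variable C : R.
Hypothesis cT : compact [set: T].
Hypothesis C1 : 1 <= C.
Hypothesis bT : bounded_turning T C.
Hypothesis uT : forall x y, x <> y -> exists! A : set T, jordan_arc x y A.

Lemma hull_arc x y : x <> y -> exists f : R -> T,
  [/\ {within `[0, 1], continuous f}, f 0 = x, f 1 = y,
      hull x y = f @` `[0, 1] &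
      forall s t, 0 <= s <= 1 -> 0 <= t <= 1 -> f s = f t -> s = t].
Proof.
move=> xy; have [A [Axy _]] := uT xy; have [f [g [cf _ fA fg [f0 f1]]]] := Axy.
have kI : connected (`[(0 : R), 1] : set R) by exact: segment_connected.
have cI : compact (`[(0 : R), 1] : set R) by exact: segment_compact.
have cA : compact (f @` `[0, 1]) by exact: continuous_compact.
have kA : connected (f @` `[0, 1]) by exact: connected_continuous_connected.
have I0 : `[0, 1]%classic (0 : R) by rewrite /= in_itv/= lexx ler01.
have I1 : `[0, 1]%classic (1 : R) by rewrite /= in_itv/= lexx ler01.
exists f; split=> //; last first.
  by move=> s t s01 t01 fst; rewrite -(fg s) ?in_itv// fst fg ?in_itv.
apply/seteqP; split=> w.
  by move=> h; apply: h => //; [rewrite -f0; exists 0|rewrite -f1; exists 1].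
rewrite fA => Aw E cE kE Ex Ey.
apply: (arc_sub_connected cT C1 bT uT _ kE Ex Ey xy Axy Aw).
by apply: compact_closed => //; exact: metric_hausdorff.
Qed.

Lemma arc_image_continuum (f : R -> T) (s t : R) : {within `[0, 1], continuous f} ->
  0 <= s -> t <= 1 -> compact (f @` `[s, t]) /\ connected (f @` `[s, t]).
Proof.
move=> cf s0 t1; have cst : {within `[s, t], continuous f}.
  apply: continuous_subspaceW cf => u; rewrite /= !in_itv/= => /andP[su ut].
  by rewrite (le_trans s0 su) (le_trans ut t1).
split; first by apply: continuous_compact => //; exact: segment_compact.
by apply: connected_continuous_connected => //; exact: segment_connected.
Qed.

(** A continuum through [f s] and [f t], completed by the two outer pieces of the arc, joins [x] to
    [y] and hence contains [f u]; by injectivity the outer pieces do not account for [f u] unless u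
    is s or t. *)
Lemma hull_subarc x y (f : R -> T) (s u t : R) :
  {within `[0, 1], continuous f} -> f 0 = x -> f 1 = y ->
  hull x y = f @` `[0, 1] ->
  (forall s t, 0 <= s <= 1 -> 0 <= t <= 1 -> f s = f t -> s = t) ->
  0 <= s -> s <= u -> u <= t -> t <= 1 -> hull (f s) (f t) (f u).
Proof.
move=> cf f0 f1 hE inj s0 su ut t1 E cE kE Es Et.
have : hull x y (f u) by rewrite hE; exists u => //=; rewrite in_itv/=; lra.
have [c0s k0s] := @arc_image_continuum f 0 s cf (lexx 0) ltac:(lra).
have [ct1 kt1] := @arc_image_continuum f t 1 cf ltac:(lra) (lexx 1).
have fs : (f @` `[0, s]) (f s) by exists s => //=; rewrite in_itv/= s0 lexx.
have ft : (f @` `[t, 1]) (f t) by exists t => //=; rewrite in_itv/= t1 lexx.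
move=> /(_ (f @` `[0, s] `|` (E `|` f @` `[t, 1]))) [].
- by apply: compactU => //; exact: compactU.
- apply: connectedU => //; first by exists (f s); split=> //; left.
  by apply: connectedU => //; exists (f t).
- by left; exists 0 => //=; rewrite in_itv/= lexx.
- by right; right; exists 1 => //=; rewrite in_itv/= lexx andbT.
- move=> [v]; rewrite /= in_itv/= => /andP[v0 vs] /inj E'.
  have vu : v = u by apply: E'; lra.
  by have -> : u = s by lra.
- case=> // -[v]; rewrite /= in_itv/= => /andP[v0 vs] /inj E'.
  have vu : v = u by apply: E'; lra.
  by have -> : u = t by lra.
Qed.

Lemma hull_continuum x y : compact (hull x y) /\ connected (hull x y).
Proof.
have [<-|xy] := pselect (x = y).
  have -> : hull x x = [set x].
    by apply/seteqP; split=> w; [exact: hull_refl|move=> ->; exact: hull_left].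
  by split; [exact: compact_set1|exact: connected1].
have [f [cf _ _ -> _]] := hull_arc xy.
exact: arc_image_continuum.
Qed.

Lemma hull_anti p a b : hull p b a -> hull p a b -> a = b.
Proof.
have [<-|pb] := pselect (p = b); first by move=> /hull_refl.
have [f [cf f0 f1 hE inj]] := hull_arc pb.
rewrite hE => -[s]; rewrite /= in_itv/= => /andP[s0 s1] <- pab.
have [c0s k0s] := @arc_image_continuum f 0 s cf (lexx 0) s1.
have [] := pab _ c0s k0s.
- by exists 0 => //=; rewrite in_itv/= lexx.
- by exists s => //=; rewrite in_itv/= lexx s0.
move=> v; rewrite /= in_itv/= => /andP[v0 vs]; rewrite -f1 => /inj E'.
have v1 : v = 1 by apply: E'; lra.
by have -> : s = 1 by lra.
Qed.

Lemma hull_total p x a b : hull p x a -> hull p x b -> hull p b a \/ hull p a b.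
Proof.
have [<-|px] := pselect (p = x).
  by move=> /hull_refl -> _; left; exact: hull_left.
have [f [cf f0 f1 hE inj]] := hull_arc px.
rewrite hE => -[s]; rewrite /= in_itv/= => /andP[s0 s1] <- [t].
rewrite /= in_itv/= => /andP[t0 t1] <-.
have [st|/ltW ts] := leP s t; [left|right]; rewrite -f0;
  by apply: (hull_subarc cf f0 f1 hE inj).
Qed.

(** The connected set [hull p x] is covered by the closed sets [hull p y] and [hull y x], and meets
    both, so it meets their intersection. *)
Lemma hull_median p x y : exists z, [/\ hull p x z, hull p y z & hull x y z].
Proof.
have [cpx kpx] := hull_continuum p x; have [cpy kpy] := hull_continuum p y.
have [cyx kyx] := hull_continuum y x.
have hT := @metric_hausdorff _ T.
have clpy := compact_closed hT cpy; have clyx := compact_closed hT cyx.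
apply: contrapT => nz.
have disj w : hull p x w -> hull p y w -> hull y x w -> False.
  by move=> h1 h2 h3; apply: nz; exists w; split=> //; rewrite hullC.
have E : hull p x `&` hull p y = hull p x.
  apply: kpx.
  - by exists p; split; exact: hull_left.
  - exists (~` hull y x); first exact: closed_openC.
    apply/seteqP; split=> w [h1 h2]; split=> //.
      by move=> h3; exact: (disj w).
    by case: (@hull_triangle p y x w h1).
  - by exists (hull p y).
have := @hull_right p x; rewrite -E => -[h1 h2].
by apply: (disj x) => //; exact: hull_right.
Qed.

End Hull.

(** * Heights on trees *)

Section SortedLists.
Variables (X : eqType) (r : rel X).
Hypotheses (r_trans : transitive r) (r_anti : antisymmetric r).

Lemma sorted_filter_downset (P : pred X) (s : seq X) : sorted r s ->
  (forall a b, r a b -> P b -> P a) -> s = seq.filter P s ++ seq.filter (predC P) s.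
Proof.
move=> + Pr; elim: s => //= a s IH as_.
have /allP mins := order_path_min r_trans as_.
have ss := path_sorted as_; have [Pa|nPa] /= := boolP (P a); first by rewrite -IH.
have nPs b : b \in s -> ~~ P b by move=> /mins /Pr ab; apply: contra nPa.
have -> : seq.filter P s = [::].
  by apply/eqP; rewrite -(negbK (_ == _)) -has_filter; apply/hasPn.
have -> // : seq.filter (predC P) s = s.
by apply/all_filterP/allP => b /nPs.
Qed.

Lemma sorted_filter_prefix x0 (s1 t1 : seq X) : reflexive r -> s1 <> [::] ->
  sorted r (s1 ++ t1) -> uniq (s1 ++ t1) ->
  seq.filter (r^~ (last x0 s1)) (s1 ++ t1) = s1.
Proof.
move=> rr; case/lastP: s1 => // s w _; rewrite last_rcons => srt unq.
rewrite filter_cat; have -> : seq.filter (r^~ w) (rcons s w) = rcons s w.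
  apply/all_filterP/allP => v; rewrite mem_rcons inE => /predU1P[->//|vs].
  move: srt; rewrite -cats1 -catA.
  rewrite sorted_pairwise// pairwise_cat => /and3P[/allrelP H _ _].
  by apply: H => //; rewrite mem_cat inE eqxx.
have -> : seq.filter (r^~ w) t1 = [::]; last by rewrite cats0.
apply/eqP; rewrite -(negbK (_ == _)) -has_filter; apply/hasPn => v vt.
apply/negP => vw; move: srt; rewrite sorted_pairwise// pairwise_cat => /and3P[/allrelP H _ _].
have wv : r w v by apply: H => //; rewrite mem_rcons inE eqxx.
have wE : w = v by apply: r_anti; rewrite wv.
move: unq; rewrite cat_uniq => /and3P[_ /hasPn/(_ _ vt) + _].
by rewrite -wE mem_rcons inE eqxx.
Qed.

Lemma sorted_gapless (q : rel X) (s : seq X) : reflexive r -> sorted r s ->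
  (forall a b, a \in s -> b \in s -> r a b ->
     (forall c, c \in s -> r a c -> r c b -> c = a \/ c = b) -> q a b) ->
  sorted q s.
Proof.
move=> rr srt H; case: s srt H => [|x0 s'] //; set s := x0 :: s' => srt H.
have hom i j : (i <= j)%N -> (j < size s)%N -> r (nth x0 s i) (nth x0 s j).
  move=> ij js; apply: (sorted_leq_nth r_trans rr x0 srt) => //.
  by rewrite inE (leq_ltn_trans ij).
apply/(sortedP x0) => i iS; have iS' := ltnW iS.
apply: H; [exact: mem_nth|exact: mem_nth|exact: hom|].
move=> c cs; have jS : (index c s < size s)%N by rewrite index_mem.
rewrite -(nth_index x0 cs); set j := index c s in jS * => h1 h2.
have [ji|ij] := leqP j i; [left|right]; apply: r_anti.
  by rewrite h1 andbT; exact: hom.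
by rewrite h2 andTb; exact: hom.
Qed.

End SortedLists.

(** * Finite meshes and walks from the root *)

Section DiscreteHeight.
Context {R : realType} {T : metricType R}.
Implicit Types (x y z w a b : T).
Variable C : R.
Hypothesis cT : compact [set: T].
Hypothesis C1 : 1 <= C.
Hypothesis bT : bounded_turning T C.
Hypothesis uT : forall x y, x <> y -> exists! A : set T, jordan_arc x y A.

Lemma arc_mesh p q (e : R) : 0 < e -> exists W : seq T, forall a z,
  hull p q a -> hull p q z -> hull p z a -> e < mdist a z ->
  exists2 v, v \in W & [/\ hull p z v, hull p v a, v <> a & v <> z].
Proof.
move=> e0; have [<-|pq] := pselect (p = q).
  by exists [::] => a z /hull_refl -> /hull_refl ->; rewrite mdistxx; lra.
have [f [cf f0 f1 hE inj]] := hull_arc cT C1 bT uT pq.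
have [del del0 fdel] := within_continuous_unif (@segment_compact _ _ _) cf e0.
(* A step 1/n below del / 2 leaves a multiple of 1/n strictly between any two parameters at distance
   at least del. *)
have [n n0 ndel] : exists2 n : nat, 0 < n%:R :> R & 2 / n%:R < del.
  exists (Num.truncn (2 / del)).+1; first by rewrite ltr0n.
  rewrite ltr_pdivrMr ?ltr0n// mulrC -ltr_pdivrMr//.
  exact: truncnS_gt.
have [W WP] : exists W : seq T, forall i : nat, (i <= n)%N -> f (i%:R / n%:R) \in W.
  exists [seq f (i%:R / n%:R) | i <- iota 0 n.+1] => i ni; apply/mapP; exists i => //.
  by rewrite mem_iota.
exists W => a z.
rewrite hE => -[s + <-] [t + <-]; rewrite /= !in_itv/= => /andP[s0 s1] /andP[t0 t1].
move=> pa est; have [st|ts] := ltP s t; last first.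
  have E : f s = f t.
    apply: (hull_anti cT C1 bT uT pa).
    by rewrite -f0; apply: (hull_subarc cf f0 f1 hE inj).
  by move: est; rewrite E mdistxx; lra.
have dst : del <= t - s.
  rewrite leNgt; apply/negP => h; move: est; apply/negP; rewrite -leNgt ltW//.
  by apply: fdel; rewrite /= ?in_itv/= ?s0 ?t0// distrC ger0_norm ?subr_ge0// ltW.
pose i := (Num.truncn (s * n%:R)).+1.
have sn0 : 0 <= s * n%:R by rewrite mulr_ge0// ltW.
have /andP[i1 i2] := truncn_itv sn0.
have si : s < i%:R / n%:R by rewrite ltr_pdivlMr.
have it : i%:R / n%:R < t.
  rewrite ltr_pdivrMr// -[i]addn1 natrD.
  have : 2 < (t - s) * n%:R by rewrite -ltr_pdivrMr// (lt_le_trans ndel).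
  rewrite mulrBl; lra.
have u01 : 0 <= (i%:R / n%:R : R) <= 1 by apply/andP; split; lra.
exists (f (i%:R / n%:R)).
  apply: WP; rewrite -(ler_nat R).
  move: it; rewrite ltr_pdivrMr// => it.
  by apply: le_trans (ltW it) _; rewrite ler_piMl// ltW.
split.
- by rewrite -f0; apply: (hull_subarc cf f0 f1 hE inj) => //; lra.
- by rewrite -f0; apply: (hull_subarc cf f0 f1 hE inj) => //; lra.
- by move=> /inj E; have := E u01; rewrite s0 s1 => /(_ isT) E'; lra.
- by move=> /inj E; have := E u01; rewrite t0 t1 => /(_ isT) E'; lra.
Qed.

(** Meshes of the arcs from [p] to the points q of a finite net suffice: if q is close to [b],
    bounded turning puts the median z of p, b, q within e / 2 of [b], so [a] precedes z and the mesh
    of the arc to q separates them. *)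
Lemma tree_mesh p (e : R) : 0 < e -> exists V : seq T, forall a b,
  hull p b a -> e < mdist a b ->
  exists2 v, v \in V & [/\ hull p b v, hull p v a, v <> a & v <> b].
Proof.
move=> e0; have C0 : 0 < C := lt_le_trans ltr01 C1.
have eC0 : 0 < e / 2 / C by rewrite !divr_gt0.
have [s sP] := compact_net cT eC0.
have e20 : 0 < e / 2 by rewrite divr_gt0.
have [W WP] := choice (fun q => arc_mesh p q e20).
exists (flatten (map W s)) => a b pba eab; have [q qs qb] := sP b.
have [z [zb zq zbq]] := hull_median cT C1 bT uT p b q.
have small w : hull b q w -> mdist w b < e / 2.
  move=> h; rewrite (le_lt_trans (hull_mdist bT h (@hull_left _ _ b q)))//.
  by rewrite mulrC -ltr_pdivlMr// metric_sym.
have dzb := small z zbq.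
have pza : hull p z a.
  have [//|paz] := hull_total cT C1 bT uT pba zb.
  have [//|zba] := @hull_triangle _ _ p z b a pba.
  have := small a; rewrite hullC in zba.
  by move=> /(_ (hull_subl zbq zba)) => h; exfalso; lra.
have pqa := hull_subl zq pza.
have eaz : e / 2 < mdist a z by have := metric_triangle a z b; lra.
have [v vW [pzv pva va vz]] := WP q a z pqa zq pza eaz.
exists v; first by apply/flattenP; exists (W q) => //; exact: map_f.
have pbv := hull_subl zb pzv; split=> // vb; apply: vz.
by apply: (hull_anti cT C1 bT uT pzv); rewrite vb.
Qed.

Variables (p : T) (e : R) (V : seq T).
Hypothesis e0 : 0 < e.
Hypothesis VP : forall a b, hull p b a -> e < mdist a b ->
  exists2 v, v \in V & [/\ hull p b v, hull p v a, v <> a & v <> b].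

Definition below : rel T := fun a b => `[< hull p b a >].

Lemma below_trans : transitive below.
Proof. by move=> b a c /asboolP ab /asboolP bc; apply/asboolP; exact: hull_subl ab. Qed.

Lemma below_anti : antisymmetric below.
Proof. by move=> a b /andP[/asboolP ab /asboolP ba]; exact: (hull_anti cT C1 bT uT ab ba). Qed.

Lemma below_refl : reflexive below.
Proof. by move=> a; apply/asboolP; exact: hull_right. Qed.

Definition stations x := sort below [seq v <- undup (p :: V) | below v x].

Lemma mem_stations x v : (v \in stations x) = (v \in p :: V) && below v x.
Proof. by rewrite mem_sort mem_filter mem_undup andbC. Qed.

Lemma uniq_stations x : uniq (stations x).
Proof. by rewrite sort_uniq filter_uniq// undup_uniq. Qed.

Lemma sorted_stations x : sorted below (stations x).
Proof.
apply: (@sort_sorted_in _ (below^~ x)).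
  move=> a b; rewrite !inE => ax bx; apply/orP.
  by have [h|h] := hull_total cT C1 bT uT ax bx; [left|right]; exact/asboolP.
exact: filter_all.
Qed.

Lemma stations_filter z x : below z x -> seq.filter (below^~ z) (stations x) = stations z.
Proof.
move=> zx; apply: (sorted_eq below_trans below_anti).
- by apply: path.sorted_filter (sorted_stations x); exact: below_trans.
- exact: sorted_stations.
apply: uniq_perm; [by rewrite filter_uniq ?uniq_stations|exact: uniq_stations|].
move=> v; rewrite mem_filter !mem_stations andbC -andbA; congr andb.
by case vz : (below v z); rewrite ?andbF// (below_trans vz zx).
Qed.

(** Walks to points beyond a common branch point start identically, hence share the state of the
    counter there. *)
Lemma stations_cat z x : below z x -> exists s, stations x = stations z ++ s /\
  forall v, v \in s -> hull z x v.
Proof.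
move=> zx; exists (seq.filter (predC (below^~ z)) (stations x)); split.
  rewrite -(stations_filter zx); apply: (sorted_filter_downset below_trans).
    exact: sorted_stations.
  by move=> a b ab bz; exact: below_trans ab bz.
move=> v; rewrite mem_filter mem_stations => /andP[/= /asboolPn vz /andP[_ /asboolP vx]].
by have [|] := @hull_triangle _ _ p z x v vx.
Qed.

(** Every intermediate state of the counter is thus the final state of the walk to some point of the
    arc, so a [spread] yields points where the height differs. *)
Lemma stations_prefix x (s1 t1 : seq T) : stations x = s1 ++ t1 -> s1 <> [::] ->
  stations (last p s1) = s1 /\ hull p x (last p s1).
Proof.
move=> E s10; have lx : last p s1 \in stations x.
  by rewrite E mem_cat; case: (s1) s10 => //= a s _; rewrite mem_last.
move: (lx); rewrite mem_stations => /andP[_ ltx]; split; last exact/asboolP.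
rewrite -(stations_filter ltx) E; apply: sorted_filter_prefix => //.
- exact: below_trans.
- exact: below_anti.
- exact: below_refl.
- by rewrite -E sorted_stations.
- by rewrite -E uniq_stations.
Qed.

Lemma stations_root x : exists s, stations x = p :: s.
Proof.
have : p \in stations x by rewrite mem_stations inE eqxx; apply/asboolP; exact: hull_left.
have := sorted_stations x; case: (stations x) => // a s /= /(order_path_min below_trans)/allP H.
rewrite inE => /predU1P[<-|/H ap]; first by exists s.
have pa : below p a by apply/asboolP; exact: hull_left.
by exists s; congr cons; apply: below_anti; rewrite ap.
Qed.

Lemma stations_path x : path (mdist_le e) p (stations x).
Proof.
have := sorted_gapless below_trans below_anti (q := mdist_le e) below_refl (sorted_stations x).
have [s sE] := stations_root x => H.
suff : sorted (mdist_le e) (stations x) by rewrite sE /= /mdist_le mdistxx ltW.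
apply: H => a b ax bx /asboolP ab nc; rewrite /mdist_le leNgt; apply/negP => eab.
have [v vV [vb av va nvb]] := VP ab eab.
have av' : below a v by exact/asboolP.
have vb' : below v b by exact/asboolP.
have vx : v \in stations x.
  rewrite mem_stations inE vV orbT/=; move: bx; rewrite mem_stations => /andP[_].
  exact: below_trans.
by case: (nc v vx av' vb').
Qed.

Lemma stations_last x : mdist (last p (stations x)) x <= e.
Proof.
have [s sE] := stations_root x; rewrite leNgt; apply/negP.
set a := last _ _ => eax.
have ax : a \in stations x by rewrite /a sE /= mem_last.
have pxa : hull p x a by move: ax; rewrite mem_stations => /andP[_ /asboolP].
have [v vV [xv va nva nvx]] := VP pxa eax.
have vx : v \in stations x by rewrite mem_stations inE vV orbT; exact/asboolP.
apply: nva; apply: below_anti; rewrite andbC; apply/andP; split; first exact/asboolP.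
have [sx _] := stations_prefix (esym (cats0 (stations x))) ltac:(by rewrite sE).
by move: vx; rewrite -{1}sx -/a mem_stations => /andP[].
Qed.

End DiscreteHeight.

(** * Heights at a fixed mesh size *)

Section TreeHeight.
Context {R : realType} {T : metricType R}.
Implicit Types (x y z w a b : T).
Variable C : R.
Hypothesis cT : compact [set: T].
Hypothesis C1 : 1 <= C.
Hypothesis bT : bounded_turning T C.
Hypothesis uT : forall x y, x <> y -> exists! A : set T, jordan_arc x y A.

Lemma compact_bounded : exists2 B : R, 0 < B & forall x y, mdist x y <= B.
Proof.
have [[p _]|nT] := pselect (exists p : T, True); last first.
  by exists 1 => // x; exfalso; apply: nT; exists x.
have [s sP] := compact_net cT (@ltr01 R).
pose S := \sum_(c <- s) mdist c p; exists (2 + 2 * S).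
  have : 0 <= S by apply: sumr_ge0 => c _; exact: mdist_ge0.
  lra.
have near x : mdist x p <= 1 + S.
  have [c cs cx] := sP x; have := metric_triangle x c p; rewrite (metric_sym x c).
  have : mdist c p <= S.
    by rewrite /S (big_rem c)//= lerDl sumr_ge0// => a _; exact: mdist_ge0.
  lra.
move=> x y; have := near x; have := near y; have := metric_triangle x p y.
rewrite (metric_sym p y); lra.
Qed.

Lemma pow4_unbounded (c : R) : exists k : nat, c < 4 ^+ k.
Proof.
exists (Num.truncn `|c|).+1; rewrite (le_lt_trans (ler_norm c))//.
apply: (lt_trans (truncnS_gt _)).
by rewrite -natrX ltr_nat ltn_expl.
Qed.

Lemma discrete_height p (e : R) : 0 < e -> exists F : T -> R,
  (forall x y, `|F x - F y| <= 16 * e + 64 * (C * mdist x y)) /\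
  (forall x z k, hull p x z -> mdist z x <= 3 * (e * 4 ^+ k) + 2 * e \/
    exists a b, [/\ hull z x a, hull z x b & e * 4 ^+ k <= `|F a - F b|]).
Proof.
move=> e0; have [V VP] := tree_mesh cT C1 bT uT p e0.
have [B B0 dB] := compact_bounded.
have [K' BK] := pow4_unbounded (B / e).
have K'P x y : mdist x y < e * 4 ^+ K'.
  by rewrite (le_lt_trans (dB x y))// mulrC -ltr_pdivrMr.
set K := K'.+1; have nc (S : @odometer R T) : ~~ carry e S K by exact: (carry_bounded S K'P).
pose st x := foldl (tick e) (start p) (stations p V x).
pose F x := e * height e (st x) K.
have tame_st x : tame e (st x) /\ anchor (st x) 0%N = last p (stations p V x).
  apply: tame_foldl => //; first exact: tame_start.
  exact: (stations_path cT C1 bT uT).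
have F01 x : 0 <= F x <= e * 4 ^+ K.
  have /andP[h0 h1] := height_bounds (tame_st x).1 K.
  by rewrite /F mulr_ge0 ?(ltW e0)//= ler_pM2l//; lra.
have below_of x z : hull p x z -> below p z x by move=> h; exact/asboolP.
exists F; split.
(* Both walks are compared with the state at the median of p, x, y. The bound is 16 e for k = 0;
   otherwise, at the least admissible k, it is 64 e * 4^(k-1), and e * 4^(k-1) is at most C d(x,
   y). *)
- have key x y k : C * mdist x y < e * 4 ^+ k -> `|F x - F y| <= e * (4 * 4 ^+ k.+1).
    move=> xyk; have [Kk|kK] := leqP K k.+1.
      have p4 : 4 ^+ K <= 4 ^+ k.+1 :> R by rewrite ler_eXn2l//; lra.
      have p4' : e * 4 ^+ K <= e * 4 ^+ k.+1 by rewrite ler_pM2l.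
      have p40 : 0 < e * 4 ^+ K by rewrite mulr_gt0// exprn_gt0.
      have /andP[] := F01 x; have /andP[] := F01 y; rewrite ler_norml.
      by move=> *; apply/andP; split; lra.
    have [j KE] : exists j, K = (k.+1 + j)%N by exists (K - k.+1)%N; lia.
    have [z [zx zy zxy]] := hull_median cT C1 bT uT p x y.
    have half u : hull p u z -> hull z u `<=` hull x y ->
        `|height e (st u) K - lift_height e (st z) k.+1 j 0| <= 2 * 4 ^+ k.+1.
      move=> zu zuxy.
      have [s [sE sz]] := stations_cat cT C1 bT uT V (below_of _ _ zu).
      have stE : st u = foldl (tick e) (st z) s by rewrite /st sE foldl_cat.
      rewrite stE KE; apply: height_near => //; last by rewrite -KE.
      + exact: (tame_st z).1.
      + by rewrite -stE; exact: (tame_st u).1.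
      + move=> a b /sz za /sz zb; apply: le_lt_trans xyk.
        by apply: (hull_mdist bT); exact: zuxy.
    have hx := half x zx ltac:(rewrite hullC; exact: hull_subl zxy).
    have hy := half y zy (hull_subr zxy).
    rewrite /F -mulrBr normrM (gtr0_norm e0) ler_pM2l//.
    rewrite -(subrK (lift_height e (st z) k.+1 j 0) (height e (st x) K)) -addrA.
    apply: le_trans (ler_normD _ _) _; rewrite distrC in hy.
    by apply: le_trans (lerD hx hy) _; lra.
  move=> x y; have ex : exists k, C * mdist x y < e * 4 ^+ k.
    have [k kP] := pow4_unbounded (C * mdist x y / e).
    by exists k; rewrite [ltRHS]mulrC -ltr_pdivrMr.
  have Cd : 0 <= C * mdist x y by rewrite mulr_ge0 ?mdist_ge0// (le_trans ler01).
  case: (ex_minnP ex) => -[|k] hk min; have := key x y _ hk.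
    by rewrite expr1; lra.
  have : e * 4 ^+ k <= C * mdist x y.
    by rewrite leNgt; apply/negP => /min; rewrite ltnn.
  by rewrite !exprS; lra.
- move=> x z k zx.
  have e4 : 0 < e * 4 ^+ k by rewrite mulr_gt0// exprn_gt0.
  have [Kk|kK] := ltnP K k.
    left; have p4 : e * 4 ^+ K' <= e * 4 ^+ k.
      rewrite ler_pM2l// ler_eXn2l//; last lra.
      by apply: ltnW; apply: ltn_trans Kk.
    have := K'P z x; lra.
  have [j KE] : exists j, K = (k + j)%N by exists (K - k)%N; rewrite subnKC.
  have [s [sE sz]] := stations_cat cT C1 bT uT V (below_of _ _ zx).
  have [tz az] := tame_st z.
  have ps : path (mdist_le e) (anchor (st z) 0%N) s.
    have := stations_path cT C1 bT uT e0 VP x.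
    by rewrite sE cat_path az => /andP[].
  have stE s1 : foldl (tick e) (st z) s1 = foldl (tick e) (start p) (stations p V z ++ s1).
    by rewrite foldl_cat.
  have nck (S : @odometer R T) : ~~ carry e S (k + j) by rewrite -KE.
  case: (height_spread e0 tz ps nck); last first.
    rewrite az => h; left.
    have lz := stations_last cT C1 bT uT VP z.
    have lx := stations_last cT C1 bT uT VP x.
    rewrite sE last_cat in lx.
    have := metric_triangle z (last p (stations p V z)) x.
    have := metric_triangle (last p (stations p V z)) (last (last p (stations p V z)) s) x.
    rewrite (metric_sym z (last p (stations p V z))); lra.
  have point s1 t1 : s = s1 ++ t1 -> exists2 a, hull z x a &
      F a = e * height e (foldl (tick e) (st z) s1) K.
    move=> s1E; have [->|s10] := eqVneq s1 [::].
      by exists z => //; exact: hull_left.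
    have ss : stations p V x = (stations p V z ++ s1) ++ t1 by rewrite sE s1E catA.
    have [|stl _] := stations_prefix cT C1 bT uT ss.
      by move=> /(congr1 size); rewrite size_cat; case: (s1) s10 => //= *; lia.
    exists (last p (stations p V z ++ s1)); last by rewrite /F /st stl stE.
    apply: sz; rewrite s1E last_cat mem_cat; case: (s1) s10 => //= c s1' _.
    by rewrite mem_last.
  move=> [s1 [s2 [t1 [t2 [E1 E2 h]]]]]; right.
  have [a za Fa] := point _ _ E1; have [b zb Fb] := point _ _ E2.
  exists a, b; split=> //; rewrite Fa Fb -mulrBr normrM (gtr0_norm e0) ler_pM2l//.
  by rewrite KE.
Qed.

Lemma discrete_height_light (e : R) : 0 < e -> exists F : T -> R,
  (forall x y, `|F x - F y| <= 16 * e + 64 * (C * mdist x y)) /\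
  (forall x y, 10 * e < mdist x y ->
    exists a b, [/\ hull x y a, hull x y b & mdist x y / 28 <= `|F a - F b|]).
Proof.
move=> e0; have [[p _]|nT] := pselect (exists p : T, True); last first.
  by exists (fun=> 0); split=> x; exfalso; apply: nT; exists x.
have [F [FL Flight]] := discrete_height p e0; exists F; split=> // x y xy.
have half u z : hull p u z -> 5 * e < mdist z u ->
    exists a b, [/\ hull z u a, hull z u b & mdist z u / 14 <= `|F a - F b|].
  move=> zu dzu; have ex : exists k, mdist z u <= 3 * (e * 4 ^+ k) + 2 * e.
    have [k kP] := pow4_unbounded (mdist z u / e); exists k.
    have : mdist z u < e * 4 ^+ k by rewrite mulrC -ltr_pdivrMr.
    have := mdist_ge0 z u; lra.
  (* At the least scale the distance is at most 12 e * 4^k + 2 e, hence at most 14 e * 4^k; the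
     longer half of the arc from x to y then costs the factor 28. *)
  case: (ex_minnP ex) => -[|k] hk min; first by move: hk; rewrite expr0; lra.
  have [h|[a [b [za zb h]]]] := Flight u z k zu.
    by have := min _ h; rewrite ltnn.
  exists a, b; split=> //; apply: le_trans h; move: hk; rewrite exprS.
  have : e <= e * 4 ^+ k by rewrite -[leLHS]mulr1 ler_pM2l// exprn_ege1//; lra.
  lra.
have [z [zx zy zxy]] := hull_median cT C1 bT uT p x y.
have tri := metric_triangle x z y; rewrite (metric_sym x z) in tri.
have [h|h] := leP (mdist x y / 2) (mdist z x).
  have [|a [b [za zb ab]]] := half x z zx; first lra.
  have sub : hull z x `<=` hull x y by rewrite hullC; exact: hull_subl.
  by exists a, b; split; [exact: sub|exact: sub|lra].
have [|a [b [za zb ab]]] := half y z zy; first lra.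
have sub : hull z y `<=` hull x y by exact: hull_subr.
by exists a, b; split; [exact: sub|exact: sub|lra].
Qed.

End TreeHeight.

(** * The limit height and its fold *)

Section TreeHeightLimit.
Context {R : realType} {T : metricType R}.
Implicit Types (x y z w a b : T).
Variable C : R.
Hypothesis cT : compact [set: T].
Hypothesis C1 : 1 <= C.
Hypothesis bT : bounded_turning T C.
Hypothesis uT : forall x y, x <> y -> exists! A : set T, jordan_arc x y A.

Lemma lipschitz_continuous (F : T -> R) (L : R) :
  (forall x y, `|F x - F y| <= L * mdist x y) -> continuous F.
Proof.
move=> FL x V /nbhs_ballP[e /= e0 xV]; apply/nbhs_mdistP.
have L0 : 0 < `|L| + 1 by rewrite ltr_wpDl.
exists (e / (`|L| + 1)); first by rewrite divr_gt0.
move=> y xy; apply: xV; rewrite -ball_normE/=.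
apply: (le_lt_trans (FL x y)); rewrite ltr_pdivlMr// in xy.
apply: le_lt_trans xy; rewrite mulrC ler_wpM2l ?mdist_ge0//.
by have := ler_norm L; lra.
Qed.

Lemma connected_ivt (E : set T) (F : T -> R) x y (c : R) : connected E ->
  continuous F -> E x -> E y -> F x <= c -> c <= F y -> exists2 w, E w & F w = c.
Proof.
move=> kE cF Ex Ey xc cy.
have kFE : connected (F @` E).
  by apply: connected_continuous_connected => //; exact: continuous_subspaceT.
have [w Ew <-] : (F @` E) c; last by exists w.
apply: ((connected_intervalP _).1 kFE (F x) (F y)); [by exists x|by exists y|].
by rewrite xc cy.
Qed.

Lemma tree_height : exists F : T -> R,
  (forall x y, `|F x - F y| <= 64 * C * mdist x y) /\
  (forall x y, exists a b, [/\ hull x y a, hull x y b &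
     mdist x y / 28 <= `|F a - F b|]).
Proof.
have [[p _]|nT] := pselect (exists p : T, True); last first.
  by exists (fun=> 0); split=> x; exfalso; apply: nT; exists x.
have C0 : 0 < C := lt_le_trans ltr01 C1.
have [B B0 dB] := compact_bounded cT.
pose e (n : nat) : R := n.+1%:R^-1.
have e_gt0 n : 0 < e n by rewrite invr_gt0 ltr0n.
have e_le1 n : e n <= 1 by rewrite invf_le1 ?ltr0n// ler1n.
have [G GP] := choice (fun n => discrete_height_light cT C1 bT uT (e_gt0 n)).
have GL n x y : `|G n x - G n y| <= 16 * e n + 64 * C * mdist x y.
  by rewrite -[64 * C * _]mulrA; exact: (GP n).1.
(* Normalizing at the root keeps the heights in a fixed compact interval without affecting
   differences. *)
pose F n x := G n x - G n p.
have FE n x y : F n x - F n y = G n x - G n y by rewrite /F opprB addrA subrK.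
have [U [UU ooU]] := ultrafilter_nat.
have Fb n x : `[- (16 + 64 * C * B), 16 + 64 * C * B]%classic (F n x).
  rewrite /= in_itv/= -ler_norml (le_trans (GL n x p))// lerD//.
    by rewrite ler_piMr// e_le1.
  by rewrite ler_wpM2l// mulr_ge0// ltW.
have lim x : exists l : R, forall eta : R, 0 < eta -> U [set n | `|F n x - l| < eta].
  have [l _ Fl] := ultra_compact_cvg UU (@segment_compact _ _ _) (fun n => Fb n x).
  exists l => eta eta0.
  have /Fl : nbhs l [set y | `|y - l| < eta].
    by apply/nbhs_ballP; exists eta => //= y; rewrite -ball_normE/= distrC.
  by rewrite nbhs_simpl.
have [H HP] := choice lim.
have e_small (eta : R) : 0 < eta -> U [set n | 16 * e n < eta].
  move=> eta0; apply: filterS (ooU (Num.truncn (16 / eta))) => n /= h.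
  rewrite ltr_pdivrMr ?ltr0n// mulrC -ltr_pdivrMr//.
  by apply: lt_le_trans (truncnS_gt _) _; rewrite ler_nat.
have HL x y : `|H x - H y| <= 64 * C * mdist x y.
  apply/ler_addgt0Pr => eta eta0; have eta3 : 0 < eta / 3 by rewrite divr_gt0.
  have [n [[/= hx hy] he]] := filter_ex
    (filterI (filterI (HP x _ eta3) (HP y _ eta3)) (e_small _ eta3)).
  have := GL n x y; rewrite -FE.
  have -> : H x - H y = (H x - F n x) + (F n x - F n y) + (F n y - H y) by ring.
  have := ler_normD (H x - F n x + (F n x - F n y)) (F n y - H y).
  have := ler_normD (H x - F n x) (F n x - F n y).
  rewrite distrC in hx; lra.
exists H; split=> // x y; have [xy0|xy0] := leP (mdist x y) 0.
  exists x, x; split; [exact: hull_left|exact: hull_left|].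
  by rewrite subrr normr0; lra.
have [chull _] := hull_continuum cT C1 bT uT x y.
have bad n : exists ab : T * T, [/\ hull x y ab.1, hull x y ab.2 &
    10 * e n < mdist x y -> mdist x y / 28 <= `|G n ab.1 - G n ab.2|].
  have [h|h] := ltP (10 * e n) (mdist x y).
    by have [a [b [xya xyb ab]]] := (GP n).2 x y h; exists (a, b).
  by exists (x, x); split; [exact: hull_left|exact: hull_left|].
have [ab abP] := choice bad.
have ab1 n : hull x y (ab n).1 by case: (abP n).
have ab2 n : hull x y (ab n).2 by case: (abP n).
have [a xya aP] := ultra_mdist UU chull ab1.
have [b xyb bP] := ultra_mdist UU chull ab2.
exists a, b; split=> //; apply/ler_addgt0Pr => eta eta0.
(* Six errors of eta / 6 are allowed: the two limits of the heights, and for each witness the mesh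
   term 16 [e n] and the Lipschitz term 64 C q. *)
pose q := eta / (6 * (64 * C + 1)).
have C6 : 0 < 6 * (64 * C + 1) by lra.
have q0 : 0 < q by rewrite divr_gt0.
have eta6 : 0 < eta / 6 by rewrite divr_gt0.
have qE : 64 * C * q <= eta / 6.
  have : q * (6 * (64 * C + 1)) = eta by rewrite divfK// gt_eqF.
  by lra.
have xy1 : 0 < mdist x y by [].
have [n [[[[[/= ha hb] ea] eb] e1] e2]] := filter_ex (filterI (filterI (filterI
  (filterI (filterI (HP a _ eta6) (HP b _ eta6)) (aP q q0)) (bP q q0))
  (e_small _ eta6)) (e_small _ xy1)).
have [_ _ h] := abP n; have {}h : mdist x y / 28 <= `|G n (ab n).1 - G n (ab n).2|.
  by apply: h; have := e_gt0 n; lra.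
have g1 := GL n (ab n).1 a; have g2 := GL n b (ab n).2; rewrite (metric_sym b) in g2.
have g3 : 64 * C * mdist (ab n).1 a <= eta / 6.
  by apply: le_trans qE; rewrite ler_wpM2l ?ltW// mulr_gt0.
have g4 : 64 * C * mdist (ab n).2 b <= eta / 6.
  by apply: le_trans qE; rewrite ler_wpM2l ?ltW// mulr_gt0.
rewrite distrC in hb; rewrite -!FE in g1 g2 h.
have E : F n (ab n).1 - F n (ab n).2 = (F n (ab n).1 - F n a) + (F n a - H a)
  + (H a - H b) + (H b - F n b) + (F n b - F n (ab n).2) by ring.
rewrite E in h.
have n1 := ler_normD (F n (ab n).1 - F n a + (F n a - H a) + (H a - H b) + (H b - F n b))
  (F n b - F n (ab n).2).
have n2 := ler_normD (F n (ab n).1 - F n a + (F n a - H a) + (H a - H b)) (H b - F n b).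
have n3 := ler_normD (F n (ab n).1 - F n a + (F n a - H a)) (H a - H b).
have n4 := ler_normD (F n (ab n).1 - F n a) (F n a - H a).
apply: le_trans h _; apply: le_trans n1 _.
move: n2 n3 n4 ha hb g1 g2; clear -g3 g4 e1 => *; lra.
Qed.

(* [comb] folds the height at the scale of the distance [g] to the collapsed set;
   the slow factor [eta] makes [g] negligible against the height on short arcs. *)
Lemma collapsed_height (g : T -> R) (bd : R) : (forall x, 0 <= g x <= bd) ->
  (forall x y, `|g x - g y| <= mdist x y) -> exists f : T -> R, exists L Q : R,
  [/\ 0 < L, 0 < Q,
    forall x y, `|f x - f y| <= L * Num.min (mdist x y) (g x + g y) &
    forall x y (a r : R), 0 < r -> (forall w, hull x y w -> `|f w - a| <= r) ->
      Num.min (mdist x y) (g x + g y) <= Q * r].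
Proof.
move=> gb gL; have [F [FL Flight]] := tree_height.
have C0 : 0 < C := lt_le_trans ltr01 C1.
have C1' : 1 <= C := C1.
(* On an arc with ends at distance A r the height oscillates by 17 r, more than the 16 r used below,
   while [eta * g] varies by at most eta * C * A * r = r. Then fixing the fold parameter at
   [eta * g x] costs only r. *)
pose A : R := 28 * 17; have A0 : 0 < A by rewrite /A; lra.
pose eta := (C * A)^-1.
have CA0 : 0 < C * A by rewrite mulr_gt0.
have CA1 : 1 <= C * A by rewrite /A; lra.
have eta0 : 0 < eta by rewrite invr_gt0.
have eta1 : eta <= 1 by rewrite invf_le1.
have etaCA : eta * (C * A) = 1 by rewrite mulVf// gt_eqF.
have [bd0|nbd] := leP 0 bd; last first.
  exists (fun=> 0), 1, 1; split=> // x; first by have := gb x; lra.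
  by have := gb x; lra.
pose B := eta * bd + 1.
have B0 : 0 < B by rewrite ltr_wpDl// mulr_ge0// ltW.
have hB x : 0 <= eta * g x <= B.
  have /andP[g0 g1] := gb x; rewrite mulr_ge0 ?(ltW eta0)//=.
  by rewrite /B (le_trans (ler_wpM2l (ltW eta0) g1))// lerDl.
pose f x := comb B (F x) (eta * g x).
have fle x : 0 <= f x <= 2 * g x.
  rewrite comb_ge0/=; apply: le_trans (comb_le2 B0 _ (hB x)) _.
  by have /andP[g0 _] := gb x; rewrite ler_pM2l// ler_piMl.
have cF : continuous F := lipschitz_continuous FL.
exists f, (64 * C + 2), (64 * (C * A)); split; [lra|lra| |].
  move=> x y; have m0 := mdist_ge0 x y; rewrite /Num.min; case: ifP => _.
    apply: le_trans (comb_lip B _ _ _ _) _.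
    rewrite -mulrBr normrM (gtr0_norm eta0).
    have h1 : eta * `|g x - g y| <= mdist x y.
      by apply: le_trans (gL x y); rewrite ler_piMl.
    have := FL x y; lra.
  have /andP[f0 f1] := fle x; have /andP[f2 f3] := fle y.
  have /andP[g0 _] := gb x; have /andP[g1 _] := gb y.
  have Cg : 0 <= C * (g x + g y) by rewrite mulr_ge0 ?addr_ge0// ltW.
  by rewrite ler_norml; apply/andP; split; lra.
move=> x y a r r0 fa; rewrite leNgt; apply/negP; rewrite lt_min => /andP[dxy gxy].
(* The larger of [g x] and [g y] exceeds 32 C A r, so the fold parameter there exceeds 32 r. By
   [comb_light] the fold then oscillates by more than 4 r, whereas its values all lie within 2 r of
   a. *)
wlog gx : x y fa dxy gxy / 32 * (C * A) * r < g x => [H|].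
  have [gx|gx] := ltP (32 * (C * A) * r) (g x); first exact: (H x y).
  apply: (H y x); [by rewrite hullC|by rewrite metric_sym|by rewrite addrC|lra].
have Ar0 : 0 < A * r by rewrite mulr_gt0.
have [_ kxy] := hull_continuum cT C1 bT uT x y.
have cd : continuous (mdist x).
  by apply: (@lipschitz_continuous _ 1) => u v; rewrite mul1r !(metric_sym x); exact: mdist_sub.
have [||w xyw dxw] := @connected_ivt _ (mdist x) x y (A * r) kxy cd
  (@hull_left _ _ x y) (@hull_right _ _ x y).
- by rewrite mdistxx ltW.
- apply: le_trans (ltW dxy); rewrite ler_pM2r//.
  have : A <= C * A by rewrite ler_peMl// ltW.
  lra.
have [u1 [u2 [xu1 xu2 du]]] := Flight x w.
have [_ kxw] := hull_continuum cT C1 bT uT x w.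
have h0B : 0 < eta * g x <= B.
  have /andP[_ ->] := hB x; rewrite andbT mulr_gt0//.
  by apply: lt_trans gx; rewrite !mulr_gt0.
have comb_near u : hull x w u -> `|comb B (F u) (eta * g x) - a| <= 2 * r.
  move=> xwu; have fu := fa u (hull_subl xyw xwu).
  have := comb_lip B (F u) (F u) (eta * g x) (eta * g u).
  rewrite subrr normr0 add0r -mulrBr normrM (gtr0_norm eta0).
  have d1 : `|g x - g u| <= C * (A * r).
    by apply: le_trans (gL x u) _; rewrite -dxw; apply: (hull_mdist bT (@hull_left _ _ x w) xwu).
  have d2 : eta * `|g x - g u| <= r.
    apply: le_trans (ler_wpM2l (ltW eta0) d1) _.
    suff -> : eta * (C * (A * r)) = r by [].
    by rewrite -[RHS]mul1r -etaCA; ring.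
  have := ler_normD (comb B (F u) (eta * g x) - f u) (f u - a).
  by rewrite addrA subrK /f in fu *; lra.
wlog Fu : u1 u2 xu1 xu2 du / F u1 <= F u2 => [H|].
  have [|/ltW] := leP (F u1) (F u2); first exact: (H u1 u2).
  by apply: (H u2 u1) => //; rewrite distrC.
have [t1 [t2 [t1u t2u ht]]] := comb_light B0 h0B Fu.
have attained t : F u1 <= t <= F u2 -> `|comb B t (eta * g x) - a| <= 2 * r.
  move=> /andP[ut tu]; have [u xu <-] := connected_ivt kxw cF xu1 xu2 ut tu.
  exact: comb_near.
have a1 := attained _ t1u; have a2 := attained _ t2u.
have : `|comb B t1 (eta * g x) - comb B t2 (eta * g x)| <= 4 * r.
  rewrite -(subrK a (comb B t1 _)) -addrA; apply: le_trans (ler_normD _ _) _.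
  by rewrite distrC in a2; lra.
move=> /(le_trans ht); apply/negP; rewrite -ltNge.
have hx : 32 * r < eta * g x.
  have -> : 32 * r = eta * (32 * (C * A) * r) by rewrite -[LHS]mulr1 -etaCA; ring.
  by rewrite ltr_pM2l.
have du' : 17 * r <= F u2 - F u1.
  move: du; rewrite dxw distrC ger0_norm ?subr_ge0// /A; lra.
have : 16 * r < Num.min (F u2 - F u1) (eta * g x / 2) by rewrite lt_min; apply/andP; split; lra.
lra.
Qed.

End TreeHeightLimit.

(** * The quotient *)

Lemma sorted_total_rel (X : eqType) (e : rel X) (K : X -> X -> Prop) (s : seq X) :
  (forall x y, K x y -> K y x) -> (forall y x z, K x y -> K y z -> K x z) ->
  (forall x, x \in s -> K x x) ->
  (forall x y, x \in s -> y \in s -> e x y -> K x y) -> sorted e s ->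
  forall x y, x \in s -> y \in s -> K x y.
Proof.
move=> Ksym Ktrans; case: s => // a s Krefl Kstep /= as_.
have Ka y : y \in a :: s -> K a y.
  elim/last_ind: s as_ Krefl Kstep y => [|s b IH] as_ Krefl Kstep y.
    by rewrite inE => /eqP ->; apply: Krefl; rewrite inE.
  move: as_; rewrite rcons_path -rcons_cons mem_rcons inE => /andP[as_ sb].
  have sub x : x \in a :: s -> x \in a :: rcons s b.
    by rewrite -rcons_cons mem_rcons [in X in _ -> X]inE => ->; rewrite orbT.
  have IHs y' : y' \in a :: s -> K a y'.
    apply: IH => // [x xs|x x' xs x's]; first exact/Krefl/sub.
    by apply: Kstep; exact: sub.
  move=> /predU1P[->|/IHs//]; apply: (Ktrans (last a s)).
    by apply: IHs; exact: mem_last.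
  apply: Kstep => //; first by apply: sub; exact: mem_last.
  by rewrite -rcons_cons mem_rcons inE eqxx.
by move=> x y /Ka ax /Ka ay; apply: (Ktrans a) => //; exact: Ksym.
Qed.

Lemma mdist_euclidean1 (R : realType) (u v : R) :
  mdist ((\row_(_ < 1) u)%R : euclidean R 1) ((\row_(_ < 1) v)%R : euclidean R 1) = `|u - v|.
Proof.
change (euclidean_dist (\row_(_ < 1) u : euclidean R 1) (\row_(_ < 1) v) = `|u - v|).
by rewrite /euclidean_dist big_ord1 !mxE sqrtr_sqr.
Qed.

Lemma le_diam (R : realType) (X : metricType R) (A : set X) (c : R) :
  (diam A <= c%:E)%E <-> forall x y : X, A x -> A y -> mdist x y <= c.
Proof.
split=> [dA x y Ax Ay|H].
  by rewrite -lee_fin (le_trans _ dA)//; apply: ereal_sup_ubound; exists x => //; exists y.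
by apply: ge_ereal_sup => _ [x Ax [y Ay <-]]; rewrite lee_fin; exact: H.
Qed.

Section Quotient.
Context {R : realType} {T : metricType R}.
Variables (M : set T) (cM : closed M).
Local Notation Q := (metric_quotient cM).
Implicit Types (x y z w : T) (p q : Q).

Lemma collapse_dist_min : compact [set: T] -> exists g : T -> R, exists bd : R,
  [/\ forall x, 0 <= g x <= bd, forall x y, `|g x - g y| <= mdist x y &
      forall x y, collapse_dist M x y = Num.min (mdist x y) (g x + g y)].
Proof.
move=> cT; have [B B0 dB] := compact_bounded cT.
have [[m Mm]|M0] := pselect (M !=set0); last first.
  (* For empty [M] the distance to it is infinite; a constant bounding the diameter gives the same
     minimum. *)
  exists (fun=> B), B; split=> [x|x y|x y]; first by rewrite lexx ltW.
    by rewrite subrr normr0 mdist_ge0.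
  have d0 z : dist_to M z = +oo%E.
    rewrite /dist_to; have -> : M = set0 by apply/seteqP; split=> // w Mw; case: M0; exists w.
    by rewrite image_set0 ereal_inf0.
  apply: EFin_inj; rewrite collapse_distE !d0 addey// min_l ?leey//.
  by rewrite min_l// (le_trans (dB x y))// lerDl ltW.
have fin x : dist_to M x \is a fin_num.
  rewrite ge0_fin_numE ?dist_to_ge0//; apply: le_lt_trans (ltry (mdist x m)).
  by apply: ereal_inf_lbound; exists m.
have gE x : (fine (dist_to M x))%:E = dist_to M x by rewrite fineK.
exists (fine \o dist_to M), B; split=> [x|x y|x y] /=.
- rewrite -!lee_fin gE dist_to_ge0/=.
  apply: le_trans (_ : (mdist x m)%:E <= _)%E; last by rewrite lee_fin.
  by apply: ereal_inf_lbound; exists m.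
- have := dist_to_le M x y; have := dist_to_le M y x.
  rewrite -(gE x) -(gE y) -!EFinD !lee_fin (metric_sym y x) => h1 h2.
  by rewrite ler_norml; apply/andP; split; lra.
- by apply: EFin_inj; rewrite collapse_distE EFin_min EFinD !gE.
Qed.

Lemma mdist_quotient p q : mdist p q = collapse_dist M (repr p) (repr q).
Proof. by []. Qed.

(** An r-chain of the quotient alternates moves in [T] with jumps through the collapsed point. A
    move lies over an arc on which f varies by at most L C r, and a jump joins points where g is at
    most r. So two points of a component are joined by an arc on which f is nearly constant, or each
    is joined by such an arc to a point near [M]. *)
Lemma qc_tree_quotient_dim_le1 : is_qc_tree T -> lipschitz_dim_le Q 1.
Proof.
move=> [[cT _ _ uT] [C [_ [C1 bT _]]]].
have C0 : 0 < C := lt_le_trans ltr01 C1.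
have [g [bd [gb gL gE]]] := collapse_dist_min cT.
have [f [L [K [L0 K0 fL flight]]]] := collapsed_height cT C1 bT uT gb gL.
(* An arc from a point with g at most r bounds g at its other end by r + K r' = K' r; the factor 2
   below adds the two ends. *)
pose K' := 1 + K * (1 + L * C).
have LC0 : 0 < L * C by rewrite mulr_gt0.
have K'0 : 0 < K' by rewrite /K' ltr_pwDl// mulr_ge0// ltW//; lra.
exists (fun p => \row_(_ < 1) f (repr p)), L, (2 * K'); split=> //; first lra.
  by move=> p q; rewrite mdist_euclidean1 mdist_quotient gE.
move=> r E r0 /le_diam dE U [UA Uchain _]; apply/le_diam => p q Up Uq.
have fr s t : U s -> U t -> `|f (repr s) - f (repr t)| <= r.
  move=> Us Ut; rewrite -mdist_euclidean1; apply: dE; [exact: UA Us|exact: UA Ut].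
set a := f (repr p); set r' := (1 + L * C) * r.
have r'0 : 0 < r' by rewrite mulr_gt0//; lra.
pose Bd : set T := [set w | `|f w - a| <= r'].
pose near x := exists b, g b <= r /\ hull b x `<=` Bd.
pose rel x y := hull x y `<=` Bd \/ near x /\ near y.
have near_hull x y : near x -> hull x y `<=` Bd -> near y.
  by move=> [b [gb' bx]] xy; exists b; split=> // w /(@hull_triangle _ _ b x y)[/bx|/xy].
have rsym x y : rel x y -> rel y x.
  by case=> [h|[hx hy]]; [left; rewrite hullC|right].
have rtrans y x z : rel x y -> rel y z -> rel x z.
  move=> [xy|[nx ny]] [yz|[ny' nz]].
  - by left=> w /(@hull_triangle _ _ x y z)[/xy|/yz].
  - by right; split=> //; apply: near_hull ny' _; rewrite hullC.
  - by right; split=> //; exact: near_hull ny yz.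
  - by right.
have inB s : U s -> Bd (repr s).
  move=> Us; rewrite /Bd /= (le_trans (fr _ _ Us Up))// /r'.
  by rewrite ler_peMl ?ltW//; lra.
have single s : U s -> hull (repr s) (repr s) `<=` Bd.
  by move=> Us w /hull_refl ->; exact: inB.
have [s [chain sU ps qs]] := Uchain p q Up Uq.
have : rel (repr p) (repr q).
  apply: (sorted_total_rel (K := fun s t : Q => rel (repr s) (repr t)) _ _ _ _ chain ps qs).
  - by move=> s1 s2; exact: rsym.
  - by move=> s1 s2 s3; exact: rtrans.
  - by move=> s1 /sU Us1; left; exact: single.
  move=> s1 s2 /sU Us1 /sU Us2; rewrite mdist_quotient gE ge_min => /orP[d12|g12].
    left=> w hw; rewrite /Bd /=.
    have h1 := fr _ _ Us1 Up; rewrite -/a in h1.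
    have h2 : `|f w - f (repr s1)| <= L * C * r.
      apply: le_trans (fL _ _) _; rewrite -mulrA ler_pM2l//.
      rewrite ge_min; apply/orP; left.
      apply: le_trans (hull_mdist bT hw (@hull_left _ _ _ _)) _.
      by rewrite ler_pM2l.
    have := ler_normD (f w - f (repr s1)) (f (repr s1) - a); rewrite addrA subrK /r'; lra.
  have /andP[g1 _] := gb (repr s1); have /andP[g2 _] := gb (repr s2).
  right; split; [exists (repr s1)|exists (repr s2)]; split; by [lra|exact: single].
rewrite mdist_quotient gE => -[pq|[np nq]].
  apply: le_trans (flight _ _ a r' r'0 pq) _.
  rewrite /K' /r'; have : 0 < K * (1 + L * C) by rewrite mulr_gt0//; lra.
  nra.
have gnear x : near x -> g x <= K' * r.
  move=> [b [gb' /(flight _ _ a r' r'0)]]; rewrite /K' /r' ge_min => /orP[h|h].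
    have := gL b x; have := ler_norm (g x - g b); rewrite distrC; lra.
  by have /andP[g1 _] := gb b; lra.
rewrite ge_min; apply/orP; right.
by have := gnear _ np; have := gnear _ nq; lra.
Qed.

(** All of the quotient lies over the single point of the target and is r-chain connected for every
    r > 0, so lightness bounds its diameter by K r for every r. *)
Lemma quotient_dim_le0 : connected [set: T] -> lipschitz_dim_le Q 0 ->
  forall p q, p = q.
Proof.
move=> kT [f [L [K [_ K0 _ light]]]] p q; apply: mdist_positivity.
apply/eqP; rewrite eq_le mdist_ge0 andbT; apply/ler_addgt0Pr => e e0; rewrite add0r.
pose r := e / K; have r0 : 0 < r by rewrite divr_gt0.
have d0 (u v : euclidean R 0) : mdist u v = 0.
  change (euclidean_dist u v = 0).
  by rewrite /euclidean_dist big_ord0 sqrtr0.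
have dE : (diam [set: euclidean R 0] <= r%:E)%E.
  by apply/le_diam => u v _ _; rewrite d0 ltW.
have -> : e = K * r by rewrite mulrC divfK// gt_eqF.
apply: ((le_diam setT (K * r)).1 _ p q) => //; apply: (light r setT) => //.
split=> // [p' q' _ _|V _ _ VT]; last by apply/seteqP.
pose P z := exists s : seq Q,
  path (fun u v => mdist u v <= r) p' s /\ last p' s = \pi_Q%qT z.
have [s [p's sq]] : P (repr q').
  apply: (connected_chain_ind kT r0 _ (x := repr p')) => //; last first.
    by exists [::]; split=> //=; rewrite reprK.
  move=> x y _ _ xy [s [ps sx]]; exists (rcons s (\pi_Q%qT y)).
  rewrite rcons_path ps last_rcons sx mdist_pi; split=> //=.
  rewrite -lee_fin collapse_distE ge_min; apply/orP; left.
  by rewrite lee_fin ltW.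
exists (p' :: s); split=> //; first by rewrite inE eqxx.
by rewrite -[q']reprK -sq mem_last.
Qed.

End Quotient.

(** Two distinct points are required since the quotient is a single point, of dimension 0, when [M]
    is the whole of a nonempty [T]. *)
Theorem theorem5 (R : realType) (T : metricType R) (M : set T)
    (cM : closed M) :
  is_qc_tree T ->
  (exists p q : metric_quotient cM, p <> q) ->
  lipschitz_dim (metric_quotient cM) = 1%E.
Proof.
move=> qcT [p [q pq]]; have [[_ kT _ _] _] := qcT.
apply/eqP; rewrite eq_le; apply/andP; split.
  apply: ereal_inf_lbound; exists 1%N => //.
  exact: qc_tree_quotient_dim_le1.
apply: le_ereal_inf_tmp => _ [[|n] dn <-]; last by rewrite lee_fin ler1n.
by exfalso; apply: pq; exact: (quotient_dim_le0 kT dn).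
Qed.
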